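(* For all sufficiently large $n$ the following holds for every $n$-vertex random-like graph $G=(V,E)$. (a) For every integer $k$ with $2\leq k\leq \tfrac12 n-4\sqrt{n\log n}$, there is an algorithm that, given $V$ and the family of connected $k$-sets of $G$, reconstructs $G$ in time $O(n^{k+1})$. (b) $G[S]$ is connected for every $S\subseteq V$ with $|S|\geq \tfrac12 n+4\sqrt{n\log n}$.
   Context: Logarithms are base $2$. For a graph $G=(V,E)$ and $k\geq 2$, the connected $k$-sets are the sets $X\subseteq V$ with $|X|=k$ such that $G[X]$ is connected. $N(v)$ is the neighbourhood of $v$. An $n$-vertex graph $G=(V,E)$ is random-like if: (1) for every $v\in V$, $n/2-3\sqrt{n\log n}\leq |N(v)|\leq n/2+3\sqrt{n\log n}$; (2) for every pair of distinct $v,w\in V$, $n/4-3\sqrt{n\log n}\leq |N(v)\cap (V\setminus N(w))|\leq n/4+3\sqrt{n\log n}$; (3) there are no disjoint $A,B\subseteq V$ with $|A|,|B|\geq 2\log n$ such that no edge joins $A$ and $B$. Reconstructing $G$ means outputting its labelled edge set. *)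

(* Defs.v *)
From HB Require Import structures.
From mathcomp Require Import all_boot all_order all_algebra.
From mathcomp Require Import reals exp.

Set Implicit Arguments.
Unset Strict Implicit.
Unset Printing Implicit Defensive.

Import Order.TTheory GRing.Theory Num.Theory.
Local Open Scope nat_scope.

(* A graph on the vertex set 'I_n is a symmetric irreflexive e : rel 'I_n. *)
Section Graphs.
Variables (n : nat) (e : rel 'I_n).

Definition nbhd (v : 'I_n) : {set 'I_n} := [set w | e v w].

Definition edge_set : {set {set 'I_n}} :=
  [set X : {set 'I_n} | [exists u, exists v, e u v && (X == [set u; v])]].

Definition connected_in (X : {set 'I_n}) : bool :=
  (X != set0) &&
  [forall u in X, forall v in X,
     connect [rel x y | [&& x \in X, y \in X & e x y]] u v].

Definition connected_ksets (k : nat) : {set {set 'I_n}} :=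
  [set X : {set 'I_n} | (#|X| == k) && connected_in X].

End Graphs.

Section RandomLike.
Local Open Scope ring_scope.
Variable R : realType.

Definition log2 (x : R) : R := ln x / ln 2.

Definition sqrt_nlogn (n : nat) : R := Num.sqrt (n%:R * log2 n%:R).

Definition random_like (n : nat) (e : rel 'I_n) : Prop :=
  [/\ forall v : 'I_n,
        n%:R / 2 - 3 * sqrt_nlogn n <= #|nbhd e v|%:R
          <= n%:R / 2 + 3 * sqrt_nlogn n,
      forall v w : 'I_n, v != w ->
        n%:R / 4 - 3 * sqrt_nlogn n <= #|nbhd e v :&: ~: nbhd e w|%:R
          <= n%:R / 4 + 3 * sqrt_nlogn n
    & ~ exists A B : {set 'I_n},
        [/\ [disjoint A & B],
            2 * log2 n%:R <= #|A|%:R,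
            2 * log2 n%:R <= #|B|%:R
          & forall a b, a \in A -> b \in B -> ~~ e a b] ].

End RandomLike.

(* Algorithms are structured programs for a unit-cost word RAM. A program
   mentions only finitely many registers; [heap] is the addressable memory.
   [x], [y], [z] are register numbers, and only [Const] has an immediate
   operand [c]. *)
Inductive prog : Type :=
| Skip
| Const (x c : nat)
| Add (x y z : nat)
| Sub (x y z : nat)
| Mul (x y z : nat)
| Read (x y : nat)
| Write (x y : nat)
| Seq (p q : prog)
| If (x : nat) (p q : prog)
| While (x : nat) (p : prog).

Record state : Type := State { reg : nat -> nat; heap : nat -> nat }.

Definition set_reg (s : state) (x a : nat) : state :=
  State (fun i => if i == x then a else reg s i) (heap s).

Definition set_heap (s : state) (x a : nat) : state :=
  State (reg s) (fun i => if i == x then a else heap s i).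

(* [exec W p s t s']: from [s], the program [p] halts in [s'] after exactly
   [t] unit-cost steps (instructions and tests). Words are the integers
   0, ..., W: an operation whose result exceeds W has no execution. *)
Inductive exec (W : nat) : prog -> state -> nat -> state -> Prop :=
| ExecSkip s : exec W Skip s 1 s
| ExecConst s x c : c <= W -> exec W (Const x c) s 1 (set_reg s x c)
| ExecAdd s x y z : reg s y + reg s z <= W ->
    exec W (Add x y z) s 1 (set_reg s x (reg s y + reg s z))
| ExecSub s x y z :
    exec W (Sub x y z) s 1 (set_reg s x (reg s y - reg s z))
| ExecMul s x y z : reg s y * reg s z <= W ->
    exec W (Mul x y z) s 1 (set_reg s x (reg s y * reg s z))
| ExecRead s x y :
    exec W (Read x y) s 1 (set_reg s x (heap s (reg s y)))
| ExecWrite s x y :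
    exec W (Write x y) s 1 (set_heap s (reg s x) (reg s y))
| ExecSeq p q s1 s2 s3 t1 t2 :
    exec W p s1 t1 s2 -> exec W q s2 t2 s3 ->
    exec W (Seq p q) s1 (t1 + t2) s3
| ExecIfTrue x p q s s' t : reg s x != 0 ->
    exec W p s t s' -> exec W (If x p q) s t.+1 s'
| ExecIfFalse x p q s s' t : reg s x = 0 ->
    exec W q s t s' -> exec W (If x p q) s t.+1 s'
| ExecWhileTrue x p s1 s2 s3 t1 t2 : reg s1 x != 0 ->
    exec W p s1 t1 s2 -> exec W (While x p) s2 t2 s3 ->
    exec W (While x p) s1 (t1 + t2).+1 s3
| ExecWhileFalse x p s : reg s x = 0 -> exec W (While x p) s 1 s.

(* [L] lists every member of [F] exactly once, in some order; each member is
   itself given by its elements without repetition, in some order. *)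
Definition listing (n : nat) (F : {set {set 'I_n}}) (L : seq (seq 'I_n)) :
    bool :=
  all uniq L && perm_eq [seq [set x in l] | l <- L] (enum F).

Definition words (n : nat) (L : seq (seq 'I_n)) : seq nat :=
  [seq nat_of_ord x | x <- flatten L].

(* Registers 0, 1, 2 hold n, k and the number of sets; the sets are stored
   consecutively from heap address 0; all other cells are 0. *)
Definition input_state (n k : nat) (L : seq (seq 'I_n)) : state :=
  State (nth 0 [:: n; k; size L]) (nth 0 (words L)).

(* Register 0 holds the number of edges and register 1 the address from which
   their end points are stored, two consecutive cells per edge. *)
Definition outputs_edges (n : nat) (e : rel 'I_n) (s : state) : Prop :=
  exists L : seq (seq 'I_n),
    [/\ listing (edge_set e) L,
        reg s 0 = size L
      & forall i, i < size (words L) ->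
          heap s (reg s 1 + i) = nth 0 (words L) i].

(* [P], given n, k and the connected k-sets of [e] listed in any order, outputs
   the edge set of [e] within [T] steps, using words of value at most [T]. *)
Definition reconstructs_in (P : prog) (T n k : nat) (e : rel 'I_n) : Prop :=
  forall L : seq (seq 'I_n), listing (connected_ksets e k) L ->
    exists (t : nat) (s : state),
      [/\ exec T P (input_state k L) t s, t <= T & outputs_edges e s].

(* Main.v *)
Require Import Defs.
From HB Require Import structures.
From mathcomp Require Import all_boot all_order all_algebra.
From mathcomp Require Import reals exp.
From mathcomp Require Import zify ring lra.

(* Let q = sqrt(n log n). The program decides adjacency by an exchange test.
   If A is a connected k-set and v lies outside A, then v has a neighbour in A
   exactly when some A - y + v with y in A is connected: a connected (k+1)-set
   has a non-cut vertex other than v, and v is not isolated in a connected set.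
   When u and v are distinct and non-adjacent, let S be the set of
   non-neighbours of v. The component C of u in G[S] contains N(u) \ N(v), hence
   is larger than 2 log n, so condition (3) leaves fewer than 2 log n vertices
   in S \ C; therefore |C| >= n/2 - 4q >= k, and C contains a connected k-set A
   through u that shows u and v to be non-adjacent. Part (b) is similar: in
   G[S] every degree is at least q, so two components would contradict (3).

   Subsets are looked up in a table indexed by their increasing enumeration
   read in base n. There are m <= n^k / k! connected k-sets and the tests cost
   O(m n k^3), which is O(n^(k+1)) because k^3 = O(k!). *)

Set Implicit Arguments.
Unset Strict Implicit.
Unset Printing Implicit Defensive.

Import Order.TTheory GRing.Theory Num.Theory.
Local Open Scope nat_scope.

(** * Connected vertex sets *)

Section Connectivity.
Variables (n : nat) (e : rel 'I_n).
Hypothesis e_sym : symmetric e.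
Implicit Types (A B X Z S C : {set 'I_n}) (u v x z : 'I_n).

Let within X : rel 'I_n := [rel x y | [&& x \in X, y \in X & e x y]].

Let within_sym X : connect_sym (within X).
Proof. by apply: sym_connect_sym => x y; rewrite /within /= e_sym andbCA. Qed.

Lemma connected_inP X u v :
  connected_in e X -> u \in X -> v \in X -> connect (within X) u v.
Proof. by case/andP=> _ /forall_inP cX uX vX; have /forall_inP := cX u uX; apply. Qed.

Lemma connected_in_from X u : u \in X ->
  (forall v, v \in X -> connect (within X) u v) -> connected_in e X.
Proof.
move=> uX cu; apply/andP; split; first by apply/set0Pn; exists u.
apply/forall_inP => v vX; apply/forall_inP => w wX.
apply: connect_trans (cu w wX); change (connect (within X) v u).
by rewrite within_sym cu.
Qed.

Lemma connected_in1 u : connected_in e [set u].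
Proof. by apply: (connected_in_from (set11 u)) => v /set1P->; apply: connect0. Qed.

(** Otherwise [Z] would be closed under adjacency within [X], and a path in [X] from [u] to [v]
    could not leave it. *)
Lemma connected_in_edge_out X Z u v : connected_in e X -> Z \subset X ->
  u \in Z -> v \in X -> v \notin Z ->
  exists z x, [/\ z \in Z, x \in X, x \notin Z & e z x].
Proof.
move=> cX /subsetP ZX uZ vX vZ.
case: (pickP (fun p : 'I_n * 'I_n =>
    [&& p.1 \in Z, p.2 \in X, p.2 \notin Z & e p.1 p.2])) => [[z x]|none].
  by move=> /and4P[*]; exists z, x.
have cl : closed (within X) Z.
  apply: intro_closed => // x y /and3P[_ yX xy] xZ.
  by have := none (x, y); rewrite /= xZ yX xy andbT => /negbFE.
have := closed_connect cl (connected_inP cX (ZX u uZ) vX).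
by rewrite uZ (negPf vZ).
Qed.

Lemma connected_inU1 Z x z :
  connected_in e Z -> z \in Z -> e z x -> connected_in e (x |: Z).
Proof.
move=> cZ zZ zx; apply: (@connected_in_from _ z) => [|v].
  by rewrite in_setU zZ orbT.
move=> /setU1P[->|vZ].
  by apply: connect1; rewrite /within /= !inE eqxx zZ orbT.
apply: connect_sub (connected_inP cZ zZ vZ) => a b /and3P[aZ bZ ab].
by apply: connect1; rewrite /within /= !inE aZ bZ ab !orbT.
Qed.

(** Grow the singleton of [u] by one vertex at a time, each time along an edge that leaves the
    current set inside [X]. *)
Lemma connected_in_subset X u k :
  connected_in e X -> u \in X -> 0 < k <= #|X| ->
  exists Z, [/\ Z \subset X, u \in Z, #|Z| = k & connected_in e Z].
Proof.
move=> cX uX; elim: k => [//|k IHk] /andP[_ kX].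
case: (posnP k) => [->|k0].
  by exists [set u]; rewrite sub1set uX set11 cards1 connected_in1.
have [|Z [ZX uZ Zk cZ]] := IHk; first by rewrite k0 ltnW.
have /properP[_ [v vX vZ]] : Z \proper X by rewrite properEcard ZX Zk.
have [z [x [zZ xX xZ zx]]] := connected_in_edge_out cX ZX uZ vX vZ.
exists (x |: Z); split.
- by rewrite subUset sub1set xX.
- by rewrite in_setU uZ orbT.
- by rewrite cardsU1 xZ Zk.
- exact: connected_inU1 zx.
Qed.

(** A connected subset of [S] through [u] of maximum size will do: an edge to a further vertex of
    [S] would let it grow. *)
Lemma component_exists S u : u \in S ->
  exists C, [/\ C \subset S, u \in C, connected_in e C
    & forall c x, c \in C -> x \in S -> x \notin C -> ~~ e c x].
Proof.
move=> uS.
have P0 : [&& [set u] \subset S, u \in [set u] & connected_in e [set u]].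
  by rewrite sub1set uS set11 connected_in1.
case: (@arg_maxnP _ [set u] (fun C : {set 'I_n} =>
  [&& C \subset S, u \in C & connected_in e C]) (fun C => #|C|) P0).
move=> C /and3P[CS uC cC] Cmax; exists C; split=> // c x cC' xS xC.
apply/negP => cx; have := Cmax (x |: C).
rewrite subUset sub1set xS CS in_setU uC orbT (connected_inU1 cC cC' cx).
by move=> /(_ isT); rewrite cardsU1 xC /=; lia.
Qed.

(** Adding [v] to [A] gives a connected set of size k + 1. A connected [k]-subset grown inside it
    from [v] keeps [v], so it misses exactly one vertex [y], and [y] lies in [A]. *)
Lemma adjacent_swap A v u k : connected_in e A -> #|A| = k -> 0 < k ->
  u \in A -> v \notin A -> e u v ->
  exists y B, [/\ y \in A, v \in B, B :\ v = A :\ y, #|B| = k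
    & connected_in e B].
Proof.
move=> cA Ak k0 uA vA uv.
have Xk : #|v |: A| = k.+1 by rewrite cardsU1 vA Ak.
have [|Z [ZX vZ Zk cZ]] := connected_in_subset (k := k) (connected_inU1 cA uA uv)
  (setU11 v A); first by rewrite Xk k0 leqnSn.
have ZA : Z :\ v \subset A.
  apply/subsetP => x /setD1P[xv /(subsetP ZX)].
  by rewrite in_setU1 (negPf xv).
have cZv : #|Z :\ v| = k.-1 by rewrite -Zk (cardsD1 v Z) vZ.
have : Z :\ v \proper A by rewrite properEcard ZA cZv Ak ltn_predL.
move=> /properP[_ [y yA yZ]]; exists y, Z; split=> //.
apply/eqP; rewrite eqEcard cZv; apply/andP; split.
  apply/subsetP => x xZ; rewrite in_setD1 (subsetP ZA) // andbT.
  by apply: contraNneq yZ => <-.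
by rewrite -Ak (cardsD1 y A) yA.
Qed.

Lemma connected_in_neighbour B v : connected_in e B -> 1 < #|B| -> v \in B ->
  exists2 x, x \in B :\ v & e v x.
Proof.
move=> cB B1 vB.
have /card_gt0P[w /setD1P[wv wB]] : 0 < #|B :\ v|.
  by move: B1; rewrite (cardsD1 v B) vB.
have [|z [x [/set1P-> xB xv vx]]] :=
    connected_in_edge_out cB _ (set11 v) wB (introN set1P (elimN eqP wv)).
  by rewrite sub1set.
by exists x => //; rewrite in_setD1 xB andbT -in_set1.
Qed.

(* The reconstruction criterion: [A] certifies that [v] has no neighbour in [A]
   when no connected [k]-set arises by exchanging an element of [A] for [v]. *)
Definition certifies (k : nat) A v : Prop :=
  forall y B, y \in A -> B \in connected_ksets e k -> v \in B ->
    B :\ v <> A :\ y.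

Lemma certifies_nonadjacent k A u v : 0 < k -> A \in connected_ksets e k ->
  u \in A -> certifies k A v -> (u != v) && ~~ e u v.
Proof.
move=> k0 Ak uA cert; have := Ak; rewrite inE => /andP[/eqP cardA cA].
(* If [v] were in [A], exchanging [v] for itself would give back [A], which is connected. *)
have vA : v \notin A by apply/negP => vA; apply: (cert v A).
apply/andP; split; first by apply: contraNneq vA => <-.
apply/negP => uv.
have [y [B [yA vB BA Bk cB]]] := adjacent_swap cA cardA k0 uA vA uv.
by apply: (cert y B); rewrite // inE Bk eqxx.
Qed.

(** As k > 1, [v] has a neighbour in any connected [k]-set [B] through it; if [B] came from an
    exchange, this neighbour would lie in [A]. *)
Lemma nonadjacent_certifies k A v : 1 < k -> A \in connected_ksets e k ->
  (forall a, a \in A -> ~~ e v a) -> certifies k A v.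
Proof.
move=> k1 Ak nvA y B yA; rewrite inE => /andP[/eqP Bk cB] vB E.
have [|x] := connected_in_neighbour cB _ vB; first by rewrite Bk.
by rewrite E => /setD1P[_ /nvA /negPf->].
Qed.

End Connectivity.

(** * Random-like graphs *)

Section Asymptotics.
Variable R : realType.
Local Open Scope ring_scope.

Lemma half_le_ln2 : 1 / 2 <= ln 2 :> R.
Proof.
have h : ln (1 + - (1 / 2)) <= - (1 / 2) :> R by apply: le_ln1Dx; lra.
have E : 1 + - (1 / 2) = 2^-1 :> R by field.
by rewrite E lnV ?posrE // in h; lra.
Qed.

(** ln x is twice ln (sqrt x), which is at most sqrt x, and dividing by ln 2 costs another factor of
    at most 2. *)
Lemma log2_le_sqrt (x : R) : 0 < x -> log2 x <= 4 * Num.sqrt x.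
Proof.
move=> x0; have s0 : 0 < Num.sqrt x by rewrite sqrtr_gt0.
have := ln_sublinear s0 => h; have l2 := half_le_ln2.
rewrite /log2 ler_pdivrMr; last lra.
rewrite -[in ln x](sqr_sqrtr (ltW x0)) lnXn // mulr2n; nra.
Qed.

Lemma log2_ge1 (x : R) : 2 <= x -> 1 <= log2 x.
Proof.
move=> x2; have l2 := half_le_ln2.
by rewrite /log2 ler_pdivlMr ?mul1r ?ler_ln ?posrE //; lra.
Qed.

(** These inequalities are all that the graph arguments use about n being large. *)
Lemma large_n : exists n0 : nat, forall n, (n0 <= n)%N ->
  [/\ 1 <= log2 (n%:R : R), 2 * log2 n%:R + 1 <= sqrt_nlogn R n
    & 2 * log2 n%:R <= n%:R / 4 - 3 * sqrt_nlogn R n].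
Proof.
exists (1024 ^ 2)%N => n n0.
have nR : 1024 ^+ 2 <= n%:R :> R by rewrite -natrX ler_nat.
set x : R := n%:R in nR *; set l := log2 x; rewrite /sqrt_nlogn -/x -/l.
have x0 : 0 < x by apply: lt_le_trans nR; rewrite exprn_gt0.
have l1 : 1 <= l by apply: log2_ge1; apply: le_trans nR; rewrite expr2; lra.
set s := Num.sqrt x; have s2 : s ^+ 2 = x by rewrite sqr_sqrtr // ltW.
have s0 : 0 <= s by apply: sqrtr_ge0.
have sb : 1024 <= s by rewrite -(ler_pXn2r (n := 2)) ?nnegrE // s2.
have ls : l <= 4 * s by apply: log2_le_sqrt.
(* Here l <= 4 s and s >= 1024 give l <= 4 x / s <= x / 256; then q <= x / 16, so x / 4 - 3 q is
   still at least x / 16. *)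
have lx : l <= x / 256 by rewrite -s2; nra.
split=> //.
- rewrite -(ler_pXn2r (n := 2)) ?nnegrE ?sqrtr_ge0 //; last lra.
  by rewrite sqr_sqrtr; nra.
- have q : Num.sqrt (x * l) <= x / 16.
    rewrite -(ler_pXn2r (n := 2)) ?nnegrE ?sqrtr_ge0 //; last lra.
    by rewrite sqr_sqrtr; nra.
  by lra.
Qed.

End Asymptotics.

(** * Connectivity and certificates in random-like graphs *)

Section RandomLikeGraphs.
Local Open Scope ring_scope.
Variables (R : realType) (n : nat) (e : rel 'I_n).
Hypotheses (e_sym : symmetric e) (e_irr : irreflexive e).
Hypothesis rl : random_like R e.
Hypothesis log_ge1 : 1 <= log2 (n%:R : R).
Hypothesis log_le_sqrt : 2 * log2 n%:R + 1 <= sqrt_nlogn R n.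
Hypothesis log_le_n : 2 * log2 n%:R <= n%:R / 4 - 3 * sqrt_nlogn R n.

(** No edge joins [C] to the rest of [S], so condition (3) forbids both to be large. *)
Lemma random_like_component (S C : {set 'I_n}) : C \subset S ->
  (forall c x, c \in C -> x \in S -> x \notin C -> ~~ e c x) ->
  2 * log2 (n%:R : R) <= #|C|%:R -> #|S :\: C|%:R < 2 * log2 (n%:R : R).
Proof.
move=> CS out lC; have [_ _ no] := rl; rewrite ltNge; apply/negP => lD.
apply: no; exists C, (S :\: C); split=> //.
  by rewrite -setI_eq0; apply/eqP/setP => x; rewrite !inE; case: (x \in C).
by move=> a b aC /setDP[bS bC]; apply: out.
Qed.

Lemma random_like_connected (S : {set 'I_n}) :
  n%:R / 2 + 4 * sqrt_nlogn R n <= #|S|%:R -> connected_in e S.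
Proof.
move=> Sbig; have [deg _ _] := rl.
(* [lra] is given bare real variables: [x] stands for n, [d] and [s] for the sizes of N(u) and [S],
   [i] for that of their intersection. *)
have real_deg (x d s i l q : R) : 2 * l + 1 <= q -> x / 2 - 3 * q <= d ->
    x / 2 + 4 * q <= s -> d + s <= x + i -> 2 * l <= i by lra.
have degS u : 2 * log2 (n%:R : R) <= #|nbhd e u :&: S|%:R.
  have /andP[du _] := deg u.
  have uI : (#|nbhd e u| + #|S| <= n + #|nbhd e u :&: S|)%N.
    by rewrite -cardsUI leq_add2r -[leqRHS]card_ord max_card.
  move: uI; rewrite -(ler_nat R) !natrD => uI.
  exact: real_deg log_le_sqrt du Sbig uI.
have /card_gt0P[u uS] : (0 < #|S|)%N.
  rewrite -(ltr_nat R); apply: lt_le_trans Sbig.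
  have pos (x l q : R) : 0 <= x -> 1 <= l -> 2 * l + 1 <= q -> 0 < x / 2 + 4 * q.
    by lra.
  exact: pos (ler0n _ _) log_ge1 log_le_sqrt.
have [C [CS uC cC out]] := component_exists e_sym uS.
have [/subset_leq_card|/subsetPn[v vS vC]] := boolP (S \subset C).
  by move=> SC; have /eqP <- : C == S by rewrite eqEcard CS.
have := random_like_component CS out.
rewrite ltNge => /(_ _)/negP[].
  (* The component of [u] contains all neighbours of [u] in [S]; below, [v] and its neighbours in
     [S] lie outside it in the same way. *)
  apply: le_trans (degS u) _; rewrite ler_nat; apply/subset_leq_card/subsetP.
  move=> x; rewrite !inE => /andP[ux xS]; apply: contraLR ux => xC.
  exact: out.
apply: le_trans (degS v) _; rewrite ler_nat; apply/subset_leq_card/subsetP.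
move=> x; rewrite !inE => /andP[vx xS]; rewrite xS andbT.
by apply: contraL vx => xC; rewrite e_sym; apply: out.
Qed.

Lemma random_like_witness (k : nat) (u v : 'I_n) : (0 < k)%N ->
  k%:R <= n%:R / 2 - 4 * sqrt_nlogn R n -> u != v -> ~~ e u v ->
  exists A, [/\ A \in connected_ksets e k, u \in A
    & forall a, a \in A -> ~~ e v a].
Proof.
move=> k0 kn uv nuv; have [deg codeg _] := rl.
pose S := ~: (v |: nbhd e v).
have inS x : (x \in S) = (x != v) && ~~ e v x by rewrite !inE negb_or.
have uS : u \in S by rewrite inS uv e_sym.
have [C [CS uC cC out]] := component_exists e_sym uS.
have lC : 2 * log2 (n%:R : R) <= #|C|%:R.
  have /andP[du _] := codeg u v uv.
  apply: (le_trans (le_trans log_le_n du)); rewrite ler_nat.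
  apply/subset_leq_card/subsetP => x; rewrite !inE => /andP[ux vx].
  apply: contraLR (ux) => xC; apply: out => //; rewrite inS vx andbT.
  by apply: contraNneq nuv => <-.
have lD := random_like_component CS out lC.
have SD : (#|S| = #|C| + #|S :\: C|)%N by rewrite -(cardsID C S) (setIidPr CS).
have SN : (#|S| + #|nbhd e v|).+1 = n.
  have := cardsC (v |: nbhd e v); rewrite -/S cardsU1 card_ord.
  have -> : v \notin nbhd e v by rewrite inE e_irr.
  by rewrite [in X in _ -> X]addnC.
have /andP[_ dv] := deg v.
(* The size of [C] is n - 1 - |N(v)| - |S \ C|, and 3 q + 2 log n + 1 <= 4 q; the 1 counts [v],
   which [S] omits. *)
have kC : (k <= #|C|)%N.
  rewrite -(ler_nat R).
  move: SN; rewrite SD => /(congr1 (fun x => x%:R : R)); rewrite -natr1 !natrD => SN.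
  have real_le (x k' c d b l q : R) : 2 * l + 1 <= q -> k' <= x / 2 - 4 * q ->
      d < 2 * l -> b <= x / 2 + 3 * q -> c + d + b + 1 = x -> k' <= c by lra.
  exact: real_le log_le_sqrt kn lD dv SN.
have [|A [AC uA Ak cA]] := connected_in_subset (k := k) e_sym cC uC.
  by rewrite k0.
exists A; split=> //; first by rewrite inE Ak eqxx.
move=> a aA; have := subsetP CS a (subsetP AC a aA).
by rewrite inS => /andP[].
Qed.

(** The left side refers only to the family of connected [k]-sets, so the program can evaluate
    it. *)
Lemma random_like_certificate (k : nat) (u v : 'I_n) : (1 < k)%N ->
  k%:R <= n%:R / 2 - 4 * sqrt_nlogn R n ->
  (exists A, [/\ A \in connected_ksets e k, u \in A & certifies e k A v])
  <-> (u != v) && ~~ e u v.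
Proof.
move=> k1 kn; split=> [[A [Ak uA cert]]|/andP[uv nuv]].
  exact: (certifies_nonadjacent e_sym (ltnW k1) Ak uA cert).
have [A [Ak uA nvA]] := random_like_witness (ltnW k1) kn uv nuv.
by exists A; split=> //; apply: nonadjacent_certifies.
Qed.

End RandomLikeGraphs.

(** * Encoding of finite sets of naturals *)

(* Horner value, in base [n], of the elements of [s] in increasing order; as a
   sum over ranks it does not depend on the order in which [s] is listed. *)
Definition code (n : nat) (s : seq nat) : nat :=
  \sum_(x <- s) x * n ^ count (fun y => y < x) s.

Lemma perm_code n s1 s2 : perm_eq s1 s2 -> code n s1 = code n s2.
Proof.
move=> p12; rewrite /code (perm_big _ p12) /=.
by apply: eq_bigr => x _; rewrite (permP p12).
Qed.

(** The head is the smallest element and has rank 0; it raises the rank of every other element by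
    one. *)
Lemma code_cons n x s : path ltn x s -> code n (x :: s) = x + n * code n s.
Proof.
move=> xs; have /allP ax := order_path_min ltn_trans xs.
rewrite /code big_cons /= ltnn /= (_ : count _ s = 0); last first.
  by apply/eqP; rewrite -leqn0 leqNgt -has_count; apply/hasPn => y /ax /=; lia.
rewrite muln1 big_distrr /=; congr addn; apply: eq_big_seq => y ys.
by rewrite (ax y ys) expnS; lia.
Qed.

Lemma code_lt n s : sorted ltn s -> all (ltn^~ n) s -> code n s < n ^ size s.
Proof.
elim: s => [|x s IHs] //; first by rewrite /code big_nil.
move=> xs /andP[/= xn sn]; rewrite code_cons // expnS.
by have := IHs (path_sorted xs) sn; nia.
Qed.

(** The smallest element is the remainder of the code modulo [n], so the digits are recovered one by
    one. *)
Lemma code_sorted_inj n s1 s2 : size s1 = size s2 ->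
  sorted ltn s1 -> sorted ltn s2 -> all (ltn^~ n) s1 -> all (ltn^~ n) s2 ->
  code n s1 = code n s2 -> s1 = s2.
Proof.
elim: s1 s2 => [|x s1 IHs] [|y s2] // [ss] xs ys /andP[/= xn sn1] /andP[/= yn sn2].
rewrite !code_cons // ![n * _]mulnC => E.
have Ex : x = y.
  have := congr1 (modn^~ n) E.
  by rewrite [x + _]addnC [y + _]addnC !modnMDl !modn_small.
subst y; congr (_ :: _); apply: IHs (path_sorted xs) (path_sorted ys) sn1 sn2 _.
  by [].
by move: E => /addnI/eqP; rewrite eqn_pmul2r; [move/eqP | lia].
Qed.

Lemma sort_ltn_sorted s : uniq s -> sorted ltn (sort leq s).
Proof.
by move=> us; rewrite ltn_sorted_uniq_leq sort_uniq us sort_sorted //; apply: leq_total.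
Qed.

Lemma code_ltX n s : uniq s -> all (ltn^~ n) s -> code n s < n ^ size s.
Proof.
move=> us sn; rewrite -(perm_code n (permEl (perm_sort leq s))).
by rewrite -(size_sort leq s) code_lt ?sort_ltn_sorted // all_sort.
Qed.

Lemma code_inj n s1 s2 : size s1 = size s2 -> uniq s1 -> uniq s2 ->
  all (ltn^~ n) s1 -> all (ltn^~ n) s2 ->
  code n s1 = code n s2 -> perm_eq s1 s2.
Proof.
move=> ss u1 u2 n1 n2; rewrite -(perm_code n (permEl (perm_sort leq s1))).
rewrite -(perm_code n (permEl (perm_sort leq s2))) => E.
apply/(perm_sortP leq_total leq_trans anti_leq).
by apply: code_sorted_inj E; rewrite ?size_sort ?all_sort ?sort_ltn_sorted.
Qed.

Definition code_except (n k j : nat) (h : nat -> nat) : nat :=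
  code n [seq h a | a <- iota 0 k & a != j].

(** Ranks obtained by counting let two nested loops evaluate the code without sorting. *)
Lemma code_exceptE n k j h : code_except n k j h =
  \sum_(0 <= a < k | a != j)
     h a * n ^ (\sum_(0 <= b < k | b != j) (h b < h a)).
Proof.
rewrite /code_except /code big_map big_filter /index_iota subn0.
apply: eq_bigr => a _; congr (_ * _ ^ _).
rewrite count_map count_filter -sum1_count big_mkcond [RHS]big_mkcond /=.
by apply: eq_bigr => b _; case: (b != j); case: (h b < h a).
Qed.

(** * Program logic for the word RAM *)

Fixpoint writes (p : prog) : seq nat :=
  match p with
  | Skip | Write _ _ => [::]
  | Const x _ | Add x _ _ | Defs.Sub x _ _ | Mul x _ _ | Read x _ => [:: x]
  | Seq p q => writes p ++ writes q
  | If _ p q => writes p ++ writes q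
  | While _ p => writes p
  end.

Lemma exec_frame W p s t s' : exec W p s t s' ->
  forall x, x \notin writes p -> reg s' x = reg s x.
Proof.
elim=> //=.
- by move=> {}s x c _ y; rewrite inE => /negPf ->.
- by move=> {}s x y z _ w; rewrite inE => /negPf ->.
- by move=> {}s x y z w; rewrite inE => /negPf ->.
- by move=> {}s x y z _ w; rewrite inE => /negPf ->.
- by move=> {}s x y w; rewrite inE => /negPf ->.
- move=> p1 q s1 s2 s3 t1 t2 _ IH1 _ IH2 x.
  by rewrite mem_cat negb_or => /andP[? ?]; rewrite IH2 ?IH1.
- move=> x p1 q s1 s2 t1 _ _ IH y.
  by rewrite mem_cat negb_or => /andP[? ?]; rewrite IH.
- move=> x p1 q s1 s2 t1 _ _ IH y.
  by rewrite mem_cat negb_or => /andP[? ?]; rewrite IH.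
- by move=> x p1 s1 s2 s3 t1 t2 _ _ IH1 _ IH2 y ?; rewrite IH2 ?IH1.
Qed.

(** Total correctness: asking for a run includes that no result exceeds [W], and the postcondition
    receives the step count. *)
Definition wp W p s (Q : nat -> state -> Prop) : Prop :=
  exists t s', exec W p s t s' /\ Q t s'.

Section Wp.
Variable W : nat.
Implicit Types (p q : prog) (s : state) (Q : nat -> state -> Prop).

Lemma wp_conseq p s (Q1 Q : nat -> state -> Prop) :
  wp W p s Q1 -> (forall t s', Q1 t s' -> Q t s') -> wp W p s Q.
Proof. by move=> [t [s' [E q]]] H; exists t, s'; split=> //; apply: H. Qed.

(** Registers that [p] never assigns are preserved for free, so loop invariants need not list
    them. *)
Lemma wp_frame p s Q :
  wp W p s Q ->
  wp W p s (fun t s' =>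
    (forall x, x \notin writes p -> reg s' x = reg s x) /\ Q t s').
Proof.
move=> [t [s' [E q]]]; exists t, s'; split=> //; split=> //.
exact: exec_frame E.
Qed.

Lemma wp_skip s Q : Q 1 s -> wp W Skip s Q.
Proof. by move=> q; exists 1, s; split=> //; constructor. Qed.

Lemma wp_const s Q x c :
  c <= W -> Q 1 (set_reg s x c) -> wp W (Const x c) s Q.
Proof. by move=> *; eexists _, _; split; first by constructor. Qed.

Lemma wp_add s Q x y z :
  reg s y + reg s z <= W -> Q 1 (set_reg s x (reg s y + reg s z)) ->
  wp W (Add x y z) s Q.
Proof. by move=> *; eexists _, _; split; first by constructor. Qed.

Lemma wp_sub s Q x y z :
  Q 1 (set_reg s x (reg s y - reg s z)) -> wp W (Defs.Sub x y z) s Q.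
Proof. by move=> *; eexists _, _; split; first by constructor. Qed.

Lemma wp_mul s Q x y z :
  reg s y * reg s z <= W -> Q 1 (set_reg s x (reg s y * reg s z)) ->
  wp W (Mul x y z) s Q.
Proof. by move=> *; eexists _, _; split; first by constructor. Qed.

Lemma wp_read s Q x y :
  Q 1 (set_reg s x (heap s (reg s y))) -> wp W (Read x y) s Q.
Proof. by move=> *; eexists _, _; split; first by constructor. Qed.

Lemma wp_write s Q x y :
  Q 1 (set_heap s (reg s x) (reg s y)) -> wp W (Write x y) s Q.
Proof. by move=> *; eexists _, _; split; first by constructor. Qed.

Lemma wp_seq p q s Q :
  wp W p s (fun t1 s1 => wp W q s1 (fun t2 s2 => Q (t1 + t2) s2)) ->
  wp W (Seq p q) s Q.
Proof.
move=> [t1 [s1 [E1 [t2 [s2 [E2 q2]]]]]].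
by exists (t1 + t2), s2; split=> //; apply: ExecSeq E1 E2.
Qed.

Lemma wp_if x p q s Q :
  (reg s x != 0 -> wp W p s (fun t s' => Q t.+1 s')) ->
  (reg s x = 0 -> wp W q s (fun t s' => Q t.+1 s')) ->
  wp W (If x p q) s Q.
Proof.
move=> Hp Hq; case: (eqVneq (reg s x) 0) => [x0|xn0].
  have [t [s' [E q2]]] := Hq x0.
  by exists t.+1, s'; split=> //; apply: ExecIfFalse E.
have [t [s' [E q2]]] := Hp xn0.
by exists t.+1, s'; split=> //; apply: ExecIfTrue E.
Qed.

(* Register 3 must hold 1; register [c.+1] counts the remaining iterations. *)
Definition For c N body : prog :=
  Seq (Const c 0) (Seq (Defs.Sub c.+1 N c)
    (While c.+1 (Seq body (Seq (Add c c 3) (Defs.Sub c.+1 N c))))).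

(** Each iteration costs the body plus a test, an addition and a subtraction; the last 3 counts the
    two initial instructions and the failing test. The two stability hypotheses carry [I] across the
    updates of the counters. *)
Lemma wp_for c N body s m B (I : nat -> state -> Prop) Q
    (ws := [:: c, c.+1 & writes body]) :
  reg s 3 = 1 -> reg s N = m -> m <= W ->
  3 \notin ws -> N \notin ws -> c \notin writes body ->
  (forall i s' a, I i s' -> I i (set_reg s' c a)) ->
  (forall i s' a, I i s' -> I i (set_reg s' c.+1 a)) ->
  I 0 s ->
  (forall i s', i < m -> reg s' c = i ->
     (forall x, x \notin ws -> reg s' x = reg s x) -> I i s' ->
     wp W body s' (fun t s'' => t <= B /\ I i.+1 s'')) ->
  (forall t s', t <= m * (B + 3) + 3 ->
     (forall x, x \notin ws -> reg s' x = reg s x) -> I m s' -> Q t s') ->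
  wp W (For c N body) s Q.
Proof.
move=> s3 sN mW n3 nN nc Ic Ir I0 Hbody HQ.
have nrc : (c == c.+1) = false by lia.
have fr x : x \notin ws -> ((x == c) = false) * ((x == c.+1) = false)
    * (x \notin writes body).
  by rewrite !inE !negb_or => /and3P[/negPf-> /negPf-> ->].
(* Induction on the number [d] of remaining iterations, which register [c.+1] holds. *)
have loop d : forall i s', i + d = m -> reg s' c = i -> reg s' c.+1 = d ->
    (forall x, x \notin ws -> reg s' x = reg s x) -> I i s' ->
    wp W (While c.+1 (Seq body (Seq (Add c c 3) (Defs.Sub c.+1 N c)))) s'
     (fun t s'' => [/\ t <= d * (B + 3) + 1,
        (forall x, x \notin ws -> reg s'' x = reg s x) & I m s'']).
  elim: d => [|d IHd] i s' idm sc sr Fs Is.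
    exists 1, s'; split; first by apply: ExecWhileFalse; lia.
    by split=> //; have <- : i = m by lia.
  have := Hbody i s' ltac:(lia) sc Fs Is.
  move=> /wp_frame [t1 [s1 [E1 [F1 [t1B I1]]]]].
  have s1c : reg s1 c = i by rewrite F1.
  have s13 : reg s1 3 = 1 by rewrite F1 ?Fs ?fr.
  have s1N : reg s1 N = m by rewrite F1 ?Fs ?fr.
  pose s2 := set_reg s1 c (reg s1 c + reg s1 3).
  pose s3' := set_reg s2 c.+1 (reg s2 N - reg s2 c).
  have s2c : reg s2 c = i.+1 by rewrite /= eqxx s1c s13; lia.
  have s2N : reg s2 N = m by rewrite /= (fr _ nN).
  have [t [s4 [E4 [t4 F4 I4]]]] : wp W
     (While c.+1 (Seq body (Seq (Add c c 3) (Defs.Sub c.+1 N c)))) s3'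
     (fun t s'' => [/\ t <= d * (B + 3) + 1,
        (forall x, x \notin ws -> reg s'' x = reg s x) & I m s'']).
    apply: (IHd i.+1) => //.
    - by lia.
    - by rewrite /s3' /= nrc.
    - have -> : reg s3' c.+1 = reg s2 N - reg s2 c by rewrite /= eqxx.
      by rewrite s2c s2N; lia.
    - by move=> x nx; rewrite /= !(fr _ nx) F1 ?Fs ?fr.
    - exact/Ir/Ic.
  exists ((t1 + (1 + 1)) + t).+1, s4; split.
    apply: ExecWhileTrue E4; first by rewrite sr.
    apply: ExecSeq E1 _; apply: ExecSeq; last exact: ExecSub.
    by apply: ExecAdd; lia.
  by split=> //; nia.
apply: wp_seq; apply: wp_const => //; apply: wp_seq; apply: wp_sub.
set s0 := set_reg _ _ _.
have [|||t [s' [E [Ht Hf HI]]]] := @loop m 0 s0 erefl _ _ _ (Ir _ _ _ (Ic _ _ _ I0)).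
- by rewrite /= nrc eqxx.
- by rewrite /= !eqxx (fr _ nN) sN subn0.
- by move=> x nx; rewrite /= !(fr _ nx).
by exists t, s'; split=> //; apply: HQ => //; lia.
Qed.

End Wp.

(** * The program *)

Lemma notin_subset (T : eqType) (s1 s2 : seq T) x :
  all (mem s2) s1 -> x \notin s2 -> x \notin s1.
Proof. by move=> /allP s12; apply: contra => /s12. Qed.

(* Registers 0, 1, 2, 3 hold n, k, the number m of sets, and 1; 4 and 5 hold
   the addresses m * k of the n * n table of non-edges and m * k + n * n of the
   table of entries (B :\ v, v); 6, 8, 9, 20 hold the index i of a set, its
   address i * k, a position j in it, and a vertex v. The code of set i without
   its element at position j is returned in register 16. *)
Definition code_test : prog :=
  Seq (Defs.Sub 17 13 9) (Seq (Defs.Sub 19 9 13) (Seq (Add 17 17 19)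
  (If 17 (Seq (Add 17 8 13) (Seq (Read 17 17) (Seq (Defs.Sub 17 18 17)
         (If 17 (Mul 15 15 0) Skip)))) Skip))).

(** Truncated differences in both directions add up to zero exactly when two positions agree, so
    position j is skipped. Register 15 becomes [n] to the rank of the element, and register 16
    accumulates the code. *)
Definition code_term : prog :=
  Seq (Defs.Sub 17 11 9) (Seq (Defs.Sub 18 9 11) (Seq (Add 17 17 18)
  (If 17 (Seq (Add 18 8 11) (Seq (Read 18 18) (Seq (Const 15 1)
         (Seq (For 13 1 code_test) (Seq (Mul 18 18 15) (Add 16 16 18))))))
     Skip))).

Definition code_prog : prog := Seq (Const 16 0) (For 11 1 code_term).

(** * Correctness and cost of computing a code *)

Section CodeProg.
Variables (W n k j p : nat) (H : nat -> nat).
Hypotheses (n_gt0 : 0 < n) (jk : j < k) (pkW : p + k <= W) (nkW : n ^ k <= W).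
Hypothesis codeW : code_except n k j (fun a => H (p + a)) <= W.
Definition cell a := H (p + a).

Definition code_env s := [/\ reg s 0 = n, reg s 1 = k, reg s 3 = 1, reg s 8 = p
  & reg s 9 = j].

Lemma code_env_frame (ws : seq nat) s s' :
  (forall x, x \notin ws -> reg s' x = reg s x) ->
  all (fun x => x \notin ws) [:: 0; 1; 3; 8; 9] ->
  code_env s -> code_env s'.
Proof.
move=> F /and5P[n0 n1 n3 n8 /andP[n9 _]] [*].
by split; rewrite F.
Qed.

Definition rank_below a m := \sum_(0 <= b < m | b != j) (cell b < cell a).

Lemma rank_below_le a m : rank_below a m <= m.
Proof.
rewrite /rank_below big_mkcond /=.
apply: (@leq_trans (\sum_(0 <= b < m) 1)); last by rewrite sum_nat_const_nat; lia.
by apply: leq_sum => b _; case: ifP => // _; case: (_ < _).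
Qed.

Lemma wp_code_test a b s : a < k -> b < k ->
  code_env s -> heap s = H -> reg s 13 = b -> reg s 18 = cell a ->
  reg s 15 = n ^ rank_below a b ->
  wp W code_test s (fun t s' => t <= 9 /\
    (heap s' = H /\ reg s' 15 = n ^ rank_below a b.+1)).
Proof.
move=> ak bk [s0 s1 s3 s8 s9] sH s13 s18 s15.
have E : rank_below a b.+1 = rank_below a b + (b != j) * (cell b < cell a).
  rewrite /rank_below big_mkcond big_nat_recr //= -big_mkcond /=.
  by case: (b != j); rewrite ?mul1n ?mul0n.
(* The rank stays at most [k], so the power of [n] fits into a word. *)
have L := leq_trans (rank_below_le a b.+1) bk.
apply: wp_seq; apply: wp_sub; apply: wp_seq; apply: wp_sub; apply: wp_seq.
rewrite /=.
apply: wp_add => /=; first by rewrite s13 s9; lia.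
apply: wp_if => /=; rewrite s13 s9 => bj; last first.
  apply: wp_skip; split=> //=; split => //.
  by rewrite s15 E (_ : (b != j) = false) ?mul0n ?addn0 //; apply/eqP; lia.
apply: wp_seq; apply: wp_add => /=; first by rewrite s8 s13; lia.
apply: wp_seq; apply: wp_read => /=.
apply: wp_seq; apply: wp_sub => /=.
have bj' : b != j by apply/eqP => bE; move: bj; rewrite bE; lia.
apply: wp_if => /=; rewrite s8 s13 sH s18 -/(cell b) => hab.
  have lt : cell b < cell a by lia.
  rewrite bj' lt muln1 addn1 in E.
  have X : n ^ rank_below a b * n <= W.
    by rewrite mulnC -expnS -E; apply: leq_trans nkW; apply: leq_pexp2l.
  apply: wp_mul => /=; rewrite s15 s0 //.
  by split=> //; split=> //; rewrite E expnS mulnC.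
apply: wp_skip; split=> //=; split=> //.
by rewrite s15 E (_ : (cell b < cell a) = false) ?muln0 ?addn0 //; lia.
Qed.

Definition code_prefix m :=
  \sum_(0 <= a < m | a != j) cell a * n ^ rank_below a k.

Lemma code_prefixS m : code_prefix m.+1 =
  code_prefix m + (m != j) * (cell m * n ^ rank_below m k).
Proof.
rewrite /code_prefix big_mkcond big_nat_recr //= -big_mkcond /=.
by case: (m != j); rewrite ?mul1n ?mul0n.
Qed.

(** Partial sums only grow, up to the full code, which fits into a word. *)
Lemma code_prefix_le m : m <= k -> code_prefix m <= W.
Proof.
move=> mk; apply: leq_trans codeW; rewrite code_exceptE -/(code_prefix k).
rewrite -(subnKC mk); elim: (k - m) => [|d IHd]; first by rewrite addn0.
by rewrite addnS code_prefixS; lia.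
Qed.

Lemma wp_code_term a s : a < k -> code_env s -> heap s = H -> reg s 11 = a ->
  reg s 16 = code_prefix a ->
  wp W code_term s (fun t s' => t <= k * 12 + 12 /\
    (heap s' = H /\ reg s' 16 = code_prefix a.+1)).
Proof.
move=> ak env sH s11 s16; have [s0 s1 s3 s8 s9] := env.
have := code_prefix_le ak; rewrite code_prefixS => pW.
apply: wp_seq; apply: wp_sub; apply: wp_seq; apply: wp_sub; apply: wp_seq.
apply: wp_add => /=; first by rewrite s11 s9; lia.
apply: wp_if => /=; rewrite s11 s9 => aj; last first.
  apply: wp_skip; split=> /=; first by lia.
  by split=> //; rewrite s16 (_ : (a != j) = false) ?mul0n ?addn0 //; apply/eqP; lia.
have aj' : a != j by apply/eqP => aE; move: aj; rewrite aE; lia.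
rewrite aj' mul1n in pW *.
apply: wp_seq; apply: wp_add => /=; first by rewrite s8 s11; lia.
apply: wp_seq; apply: wp_read => /=.
apply: wp_seq; apply: wp_const => /=; first by lia.
apply: wp_seq; rewrite s8 s11 sH -/(cell a).
set s' := set_reg _ 15 1.
have env' : code_env s' by [].
apply: (@wp_for _ _ _ _ _ k 9
  (fun b s => heap s = H /\ reg s 15 = n ^ rank_below a b)) => //=.
- by lia.
- by rewrite sH /rank_below big_geq.
- move=> b s2 bk s2c F [s2H s2p].
  apply: (wp_code_test ak bk _ s2H s2c) => //; last by rewrite F.
  exact: (@code_env_frame _ s' s2 F isT env').
move=> t s2 tB F [s2H s2p].
have s218 : reg s2 18 = cell a by rewrite F.
have s216 : reg s2 16 = code_prefix a by rewrite F.
apply: wp_seq; apply: wp_mul => /=; rewrite s218 s2p; first by lia.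
apply: wp_add => /=; rewrite s216; first by lia.
by split; last split; [lia | | lia].
Qed.

Lemma wp_code s Q : code_env s -> heap s = H ->
  (forall t s', t <= k * (k * 12 + 15) + 4 -> heap s' = H ->
     (forall x, x \notin writes code_prog -> reg s' x = reg s x) ->
     reg s' 16 = code_except n k j cell -> Q t s') ->
  wp W code_prog s Q.
Proof.
move=> env sH HQ; apply: wp_seq; apply: wp_const => //.
have env' : code_env (set_reg s 16 0) by [].
have [s0 s1 s3 s8 s9] := env.
apply: (@wp_for _ _ _ _ _ k (k * 12 + 12)
  (fun a s => heap s = H /\ reg s 16 = code_prefix a)) => //=.
- by lia.
- by rewrite /code_prefix big_geq.
- move=> a s2 ak s2c F [s2H s2p].
  by apply: wp_code_term => //; apply: (@code_env_frame _ (set_reg s 16 0) s2 F isT env').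
move=> t s' tB F [s'H s'p]; apply: HQ => //.
- by lia.
- move=> x nx; rewrite F; last exact: notin_subset nx.
  by move: nx; rewrite /= !inE !negb_or => /andP[/negPf->].
- by rewrite s'p code_exceptE.
Qed.

End CodeProg.

(** * Lists of addresses written by loops, and the phases of the program *)

Definition gather (T : Type) (f : nat -> seq T) (m : nat) : seq T :=
  flatten [seq f i | i <- iota 0 m].

Lemma gatherS (T : Type) (f : nat -> seq T) m :
  gather f m.+1 = gather f m ++ f m.
Proof. by rewrite /gather -addn1 iotaD map_cat flatten_cat /= cats0. Qed.

Lemma gatherP (T : eqType) (f : nat -> seq T) m x :
  reflect (exists2 i, i < m & x \in f i) (x \in gather f m).
Proof.
apply: (iffP flatten_mapP) => [[i]|[i im xi]].
  by rewrite mem_iota add0n => im xi; exists i.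
by exists i; rewrite // mem_iota.
Qed.

(** Describing a table by the list of addresses set to 1 makes repeated writes harmless. *)
Definition mark (h : nat -> nat) (ws : seq nat) (x : nat) : nat :=
  if x \in ws then 1 else h x.

Lemma mark_notin h ws x : x \notin ws -> mark h ws x = h x.
Proof. by rewrite /mark => /negPf->. Qed.

Lemma mark_cat1 h ws x y :
  mark h (ws ++ [:: x]) y = if y == x then 1 else mark h ws y.
Proof. by rewrite /mark mem_cat mem_seq1; case: (y == x); rewrite ?orbT ?orbF. Qed.

Lemma eq_code_except n k j h h' :
  (forall a, a < k -> h a = h' a) -> code_except n k j h = code_except n k j h'.
Proof.
move=> hh; rewrite /code_except; congr code; apply/eq_in_map => a.
by rewrite mem_filter mem_iota => /andP[_ /andP[_ ak]]; apply: hh.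
Qed.

(** The address is code times n plus vertex plus base, so one cell records one pair of a remainder B
    - v and the vertex v taken out. *)
Definition mark_entry : prog :=
  Seq code_prog (Seq (Mul 16 16 0) (Seq (Add 17 8 9) (Seq (Read 17 17)
  (Seq (Add 16 16 17) (Seq (Add 16 16 5) (Write 16 3)))))).

Definition mark_entries : prog :=
  For 6 2 (Seq (Mul 8 6 1) (For 9 1 mark_entry)).

Definition test_entry : prog :=
  Seq code_prog (Seq (Mul 16 16 0) (Seq (Add 16 16 20) (Seq (Add 16 16 5)
  (Seq (Read 16 16) (Add 22 22 16))))).

Definition mark_nonedge : prog :=
  Seq (Add 17 8 9) (Seq (Read 17 17) (Seq (Mul 17 17 0) (Seq (Add 17 17 20)
  (Seq (Add 17 17 4) (Write 17 3))))).

(** Register 22 counts the positions whose exchange for the vertex gives a connected set; if there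
    are none, the set certifies the vertex as non-adjacent to all its members. *)
Definition scan_vertex : prog :=
  Seq (Const 22 0) (Seq (For 9 1 test_entry)
  (If 22 Skip (For 9 1 mark_nonedge))).

Definition mark_nonedges : prog :=
  For 6 2 (Seq (Mul 8 6 1) (For 20 0 scan_vertex)).

(* The edges overwrite the table of entries, which is no longer needed; 23 is
   the next free address and 24 counts the edges. *)
Definition emit_pair : prog :=
  Seq (Defs.Sub 17 20 6)
  (If 17 (Seq (Mul 18 6 0) (Seq (Add 18 18 20) (Seq (Add 18 18 4)
         (Seq (Read 18 18)
         (If 18 Skip (Seq (Write 23 6) (Seq (Add 23 23 3) (Seq (Write 23 20)
                     (Seq (Add 23 23 3) (Add 24 24 3))))))))))
     Skip).

Definition emit_edges : prog :=
  Seq (Const 24 0) (Seq (Add 23 5 24) (For 6 0 (For 20 0 emit_pair))).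

Definition setup : prog :=
  Seq (Const 3 1) (Seq (Mul 4 2 1) (Seq (Mul 5 0 0) (Add 5 4 5))).

Definition finish : prog :=
  Seq (Const 17 0) (Seq (Add 0 24 17) (Add 1 5 17)).

Definition reconstruct : prog :=
  Seq setup (Seq mark_entries (Seq mark_nonedges (Seq emit_edges finish))).

Lemma muln_add_inj d a b v w : v < d -> w < d -> a * d + v = b * d + w ->
  a = b /\ v = w.
Proof.
move=> vd wd E; have vw : v = w.
  by have := congr1 (modn^~ d) E; rewrite !modnMDl !modn_small.
split=> //; move: E; rewrite vw => /addIn/eqP.
by rewrite eqn_pmul2r; [move/eqP | lia].
Qed.

(** * Contents of the tables, and correctness of each phase *)

Section Tables.
Variables (n k m : nat) (h0 : nat -> nat).
Definition nonedge_base := m * k.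
Definition entry_base := nonedge_base + n * n.
Definition member i a := h0 (i * k + a).
Definition rest_code i j := code_except n k j (member i).
Definition entry i j v := rest_code i j * n + v + entry_base.
Definition entry_row i := gather (fun j => [:: entry i j (member i j)]).
Definition entry_tab := gather (fun i => entry_row i k).
Definition entry_heap := mark h0 (entry_tab m).
Definition hits i v j := \sum_(0 <= j' < j) entry_heap (entry i j' v).
Definition nonedge u v := u * n + v + nonedge_base.
Definition nonedge_col i v := gather (fun j => [:: nonedge (member i j) v]).
Definition nonedge_cell i v :=
  if hits i v k == 0 then nonedge_col i v k else [::].
Definition nonedge_rows i := gather (nonedge_cell i).
Definition nonedge_tab := gather (fun i => nonedge_rows i n).
Definition nonedge_heap := mark entry_heap (nonedge_tab m).
Definition edge_cell u v :=
  if (u < v) && (nonedge_heap (nonedge u v) == 0) then [:: [:: u; v]] else [::].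
Definition edge_row u := gather (edge_cell u).
Definition edge_tab := gather (fun u => edge_row u n).
(** Marks confined to the table of non-edges disturb neither the input below it nor the entries
    above it. *)
Definition in_table (ws : seq nat) :=
  forall x, x \in ws -> nonedge_base <= x < entry_base.

Hypotheses (n_gt0 : 0 < n) (k_gt0 : 0 < k).
Hypothesis member_lt : forall i a, i < m -> a < k -> member i a < n.
Hypothesis h0_0 : forall x, nonedge_base <= x -> h0 x = 0.

Lemma nonedge_base_le : nonedge_base <= entry_base.
Proof. by rewrite /entry_base; lia. Qed.

Lemma addr_lt i a : i < m -> a < k -> i * k + a < nonedge_base.
Proof. by rewrite /nonedge_base => im ak; nia. Qed.

Lemma entry_tab_ge m' x : x < entry_base -> x \notin entry_tab m'.
Proof.
move=> xT; apply/gatherP => -[i _ /gatherP[j _]].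
by rewrite mem_seq1 /entry => /eqP xE; lia.
Qed.

Lemma entry_row_ge i j x : x < entry_base -> x \notin entry_row i j.
Proof.
by move=> xT; apply/gatherP => -[? _]; rewrite mem_seq1 /entry => /eqP xE; lia.
Qed.

Lemma entry_heap_le1 x : nonedge_base <= x -> entry_heap x <= 1.
Proof. by move=> Nx; rewrite /entry_heap /mark; case: ifP => // _; rewrite h0_0. Qed.

Lemma nonedge_lt u v : u < n -> v < n -> nonedge u v < entry_base.
Proof. by rewrite /nonedge /entry_base => un vn; nia. Qed.

Lemma nonedge_col_in i v j : i < m -> v < n -> j <= k ->
  in_table (nonedge_col i v j).
Proof.
move=> im vn jk x /gatherP[j' j'j]; rewrite mem_seq1 => /eqP->.
by rewrite leq_addl nonedge_lt // member_lt //; lia.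
Qed.

Lemma nonedge_rows_in i v : i < m -> v <= n -> in_table (nonedge_rows i v).
Proof.
move=> im vn x /gatherP[v' v'v]; rewrite /nonedge_cell; case: ifP => // _.
by apply: nonedge_col_in => //; lia.
Qed.

Lemma nonedge_tab_in i : i <= m -> in_table (nonedge_tab i).
Proof. by move=> im x /gatherP[i' i'i]; apply: nonedge_rows_in => //; lia. Qed.

Lemma in_table_cat ws1 ws2 : in_table ws1 -> in_table ws2 ->
  in_table (ws1 ++ ws2).
Proof. by move=> i1 i2 x; rewrite mem_cat => /orP[/i1|/i2]. Qed.

Lemma entry_heap_low x : x < entry_base -> entry_heap x = h0 x.
Proof. by move=> xT; rewrite /entry_heap mark_notin // entry_tab_ge. Qed.

Lemma mark_low ws x : in_table ws -> x < nonedge_base ->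
  mark entry_heap ws x = h0 x.
Proof.
move=> ws_in xN; rewrite mark_notin; first by rewrite entry_heap_low // /entry_base; lia.
by apply/negP => /ws_in; lia.
Qed.

Lemma mark_high ws x : in_table ws -> entry_base <= x ->
  mark entry_heap ws x = entry_heap x.
Proof. by move=> ws_in xN; rewrite mark_notin //; apply/negP => /ws_in; lia. Qed.

(** Every cell that is read holds 0 or 1; this keeps register 22 within a word. *)
Lemma hits_le i v j : hits i v j <= j.
Proof.
apply: (@leq_trans (\sum_(0 <= j' < j) 1)); last by rewrite sum_nat_const_nat; lia.
by apply: leq_sum => j' _; apply: entry_heap_le1; rewrite /entry /entry_base; lia.
Qed.

(** As vertices are below [n], an address determines its code and its vertex, so a marked cell comes
    from an actual set of the input. The right side is [certifies] in terms of positions and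
    codes. *)
Lemma hits0P i v : i < m -> v < n ->
  hits i v k = 0 <-> forall j1 i2 j2, j1 < k -> i2 < m -> j2 < k ->
    member i2 j2 = v -> rest_code i2 j2 <> rest_code i j1.
Proof.
move=> im vn; split=> [/eqP H j1 i2 j2 j1k i2m j2k ev ec | H].
  have : entry i j1 v \in entry_tab m.
    apply/gatherP; exists i2 => //; apply/gatherP; exists j2 => //.
    by rewrite mem_seq1 /entry ev ec.
  move: H; rewrite /hits big_mkord sum_nat_eq0 => /forallP/(_ (Ordinal j1k)) /=.
  by rewrite /entry_heap /mark; case: ifP.
rewrite /hits big_nat big1 // => j jk.
rewrite /entry_heap mark_notin ?h0_0 //; first by rewrite /entry /entry_base; lia.
apply/gatherP => -[i2 i2m /gatherP[j2 j2k]]; rewrite mem_seq1 => /eqP/addIn.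
by move=> /(muln_add_inj vn (member_lt i2m j2k))[c e]; apply: (H j i2 j2).
Qed.

Lemma nonedge_markedP u v : u < n -> v < n ->
  nonedge_heap (nonedge u v) != 0 <->
  exists i j, [/\ i < m, j < k, member i j = u
    & forall j1 i2 j2, j1 < k -> i2 < m -> j2 < k ->
        member i2 j2 = v -> rest_code i2 j2 <> rest_code i j1].
Proof.
move=> un vn.
have -> : (nonedge_heap (nonedge u v) != 0) = (nonedge u v \in nonedge_tab m).
  rewrite /nonedge_heap {1}/mark; case: ifP => // _.
  by rewrite entry_heap_low ?nonedge_lt // h0_0 // /nonedge leq_addl.
split=> [/gatherP[i im /gatherP[v' v'n]]|[i [j [im jk eu H]]]].
  rewrite /nonedge_cell; case: eqP => // H0 /gatherP[j jk]; rewrite mem_seq1 => /eqP/addIn.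
  move=> /(muln_add_inj vn v'n)[eu ev]; exists i, j; split=> //.
  by rewrite ev; apply/hits0P.
apply/gatherP; exists i => //; apply/gatherP; exists v => //.
rewrite /nonedge_cell (proj2 (hits0P im vn) H) eqxx.
by apply/gatherP; exists j => //; rewrite mem_seq1 eu.
Qed.

Lemma size_edge_row u v : size (edge_row u v) <= v.
Proof.
elim: v => [|v IHv] //; rewrite /edge_row gatherS size_cat -/(edge_row u v) /edge_cell.
by case: ifP => _ /=; lia.
Qed.

(** This bounds the room taken by the output, and hence the addresses written. *)
Lemma size_edge_tab u : size (edge_tab u) <= u * n.
Proof.
elim: u => [|u IHu] //; rewrite /edge_tab gatherS size_cat -/(edge_tab u).
by have := size_edge_row u n; lia.
Qed.

Variable W : nat.
Hypotheses (nW : n <= W) (kW : k <= W) (mW : m <= W) (nkW : n ^ k <= W).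
Hypothesis entry_baseW : entry_base + n ^ k + 2 * n * n <= W.
Hypothesis rest_code_lt : forall i j, i < m -> j < k -> rest_code i j < n ^ k.-1.

Definition env s := [/\ reg s 0 = n, reg s 1 = k, reg s 2 = m, reg s 3 = 1
  & reg s 4 = nonedge_base /\ reg s 5 = entry_base].

Lemma env_frame (ws : seq nat) s s' :
  (forall x, x \notin ws -> reg s' x = reg s x) ->
  all (fun x => x \notin ws) (iota 0 6) -> env s -> env s'.
Proof.
move=> F /and5P[n0 n1 n2 n3 /and3P[n4 n5 _]] [? ? ? ? [? ?]].
by do 2?[split; rewrite ?F //].
Qed.

(** The k - 1 remaining elements supply k - 1 digits in base [n], and [v] one more. *)
Lemma entry_lt i j v : i < m -> j < k -> v < n -> rest_code i j * n + v < n ^ k.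
Proof.
move=> im jk vn; have := rest_code_lt im jk.
by rewrite -[in n ^ k](prednK k_gt0) expnS; nia.
Qed.

Definition code_time := k * (k * 12 + 15) + 4.

Lemma wp_set_code i j s Q : i < m -> j < k ->
  env s -> reg s 8 = i * k -> reg s 9 = j ->
  (forall x, x < nonedge_base -> heap s x = h0 x) ->
  (forall t s', t <= code_time -> heap s' = heap s ->
     (forall x, x \notin writes code_prog -> reg s' x = reg s x) ->
     reg s' 16 = rest_code i j -> Q t s') ->
  wp W code_prog s Q.
Proof.
move=> im jk [s0 s1 s2 s3 [s4 s5]] s8 s9 sh HQ.
have E : code_except n k j (fun a => heap s (i * k + a)) = rest_code i j.
  by apply: eq_code_except => a ak; rewrite sh ?addr_lt.
apply: (@wp_code W n k j (i * k) (heap s)) => //.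
- by have := entry_baseW; rewrite /entry_base /nonedge_base; nia.
- rewrite E; apply: leq_trans nkW; have := entry_lt im jk n_gt0; nia.
- by move=> t s' *; apply: HQ; rewrite -?E.
Qed.

Lemma wp_mark_entry i j ws s : i < m -> j < k ->
  env s -> reg s 8 = i * k -> reg s 9 = j ->
  (forall x, x < entry_base -> x \notin ws) -> heap s =1 mark h0 ws ->
  wp W mark_entry s (fun t s' => t <= code_time + 6 /\
    heap s' =1 mark h0 (ws ++ [:: entry i j (member i j)])).
Proof.
move=> im jk E s8 s9 wsT sh; apply: wp_seq.
apply: (wp_set_code im jk E s8 s9) => [x xN|t s' tB s'h F s'16].
  by rewrite sh mark_notin // wsT // /entry_base; lia.
have [s0 s1 s2 s3 [s4 s5]] := env_frame F isT E.
have s'8 : reg s' 8 = i * k by rewrite F.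
have s'9 : reg s' 9 = j by rewrite F.
have ent := entry_lt im jk (member_lt im jk).
have ad := addr_lt im jk; have NT := nonedge_base_le.
have rd : heap s' (i * k + j) = member i j.
  by rewrite s'h sh mark_notin // wsT // /entry_base; lia.
apply: wp_seq; apply: wp_mul => /=; rewrite s'16 s0; first by lia.
apply: wp_seq; apply: wp_add => /=; rewrite s'8 s'9; first by lia.
apply: wp_seq; apply: wp_read => /=; rewrite rd.
apply: wp_seq; apply: wp_add => /=; first by lia.
apply: wp_seq; apply: wp_add => /=; rewrite s5; first by lia.
apply: wp_write => /=; split; first by lia.
by move=> x /=; rewrite mark_cat1 s3 s'h -sh.
Qed.

Lemma wp_mark_entries s Q : env s -> heap s =1 h0 ->
  (forall t s', t <= m * (k * (code_time + 9) + 7) + 3 -> env s' ->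
     heap s' =1 mark h0 (entry_tab m) -> Q t s') ->
  wp W mark_entries s Q.
Proof.
move=> E sh HQ; have [s0 s1 s2 s3 [s4 s5]] := E.
apply: (@wp_for _ _ _ _ _ m (k * (code_time + 9) + 4)
  (fun i s => heap s =1 mark h0 (entry_tab i))) => //.
- move=> i s' im s'6 F s'h.
  have E' := env_frame F isT E; have [s'0 s'1 s'2 s'3 [s'4 s'5]] := E'.
  apply: wp_seq; apply: wp_mul => /=; rewrite s'6 s'1.
    by have := entry_baseW; rewrite /entry_base /nonedge_base; nia.
  set s'' := set_reg _ _ _; have E'' : env s'' by [].
  apply: (@wp_for _ _ _ _ _ k (code_time + 6)
    (fun j s => heap s =1 mark h0 (entry_tab i ++ entry_row i j))) => //.
  + by move=> x; rewrite cats0 s'h.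
  + move=> j s3' jk s39 F3 s3h.
    have E3 := env_frame F3 isT E''.
    have s38 : reg s3' 8 = i * k by rewrite F3.
    apply: (wp_conseq (wp_mark_entry im jk E3 s38 s39 _ s3h)) => [x xT|t1 s4' [tB h]].
      by rewrite mem_cat negb_or entry_tab_ge // entry_row_ge.
    by split=> // x; rewrite h /entry_row gatherS catA.
  move=> t s3' tB F3 s3h; split; first by lia.
  by move=> x; rewrite s3h /entry_tab gatherS.
move=> t s' tB F s'h; apply: HQ => //; first by lia.
exact: env_frame F isT E.
Qed.

Lemma wp_test_entry i v j ws s : i < m -> v < n -> j < k -> in_table ws ->
  env s -> reg s 8 = i * k -> reg s 9 = j -> reg s 20 = v ->
  heap s =1 mark entry_heap ws -> reg s 22 = hits i v j ->
  wp W test_entry s (fun t s' => t <= code_time + 5 /\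
    (heap s' =1 mark entry_heap ws /\ reg s' 22 = hits i v j.+1)).
Proof.
move=> im vn jk ws_in E s8 s9 s20 sh s22; apply: wp_seq.
apply: (wp_set_code im jk E s8 s9) => [x xN|t s' tB s'h F s'16].
  by rewrite sh mark_low.
have [s0 s1 s2 s3 [s4 s5]] := env_frame F isT E.
have s'20 : reg s' 20 = v by rewrite F.
have s'22 : reg s' 22 = hits i v j by rewrite F.
have ent := entry_lt im jk vn.
have hS : hits i v j.+1 = hits i v j + entry_heap (entry i j v).
  by rewrite /hits big_nat_recr.
have := hits_le i v j.+1; rewrite hS => hB.
apply: wp_seq; apply: wp_mul => /=; rewrite s'16 s0; first by lia.
apply: wp_seq; apply: wp_add => /=; rewrite s'20; first by lia.
apply: wp_seq; apply: wp_add => /=; rewrite s5; first by lia.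
apply: wp_seq; apply: wp_read => /=.
rewrite s'h sh -/(entry i j v) mark_high //; last by rewrite /entry leq_addl.
apply: wp_add => /=; rewrite s'22; first by lia.
by split; [lia | split=> // x; rewrite s'h sh].
Qed.

Lemma wp_mark_nonedge i v j ws s : i < m -> v < n -> j < k -> in_table ws ->
  env s -> reg s 8 = i * k -> reg s 9 = j -> reg s 20 = v ->
  heap s =1 mark entry_heap ws ->
  wp W mark_nonedge s (fun t s' => t <= 6 /\
    heap s' =1 mark entry_heap (ws ++ [:: nonedge (member i j) v])).
Proof.
move=> im vn jk ws_in [s0 s1 s2 s3 [s4 s5]] s8 s9 s20 sh.
have ad := addr_lt im jk; have NT := nonedge_base_le.
have := nonedge_lt (member_lt im jk) vn; rewrite {1}/nonedge => ne.
apply: wp_seq; apply: wp_add => /=; rewrite s8 s9; first by lia.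
apply: wp_seq; apply: wp_read => /=; rewrite sh mark_low // -/(member i j).
apply: wp_seq; apply: wp_mul => /=; rewrite s0; first by lia.
apply: wp_seq; apply: wp_add => /=; rewrite s20; first by lia.
apply: wp_seq; apply: wp_add => /=; rewrite s4; first by lia.
apply: wp_write => /=; split=> // x.
by rewrite mark_cat1 /= s3 -sh.
Qed.

(** The two summands with factor [k] are the testing and the marking loop, each with 3 steps of
    overhead per iteration. *)
Definition scan_time := k * (code_time + 8) + k * 9 + 8.

Lemma wp_scan_vertex i v ws s : i < m -> v < n -> in_table ws ->
  env s -> reg s 8 = i * k -> reg s 20 = v -> heap s =1 mark entry_heap ws ->
  wp W scan_vertex s (fun t s' => t <= scan_time /\
    heap s' =1 mark entry_heap (ws ++ nonedge_cell i v)).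
Proof.
move=> im vn ws_in E s8 s20 sh; have [s0 s1 s2 s3 [s4 s5]] := E.
apply: wp_seq; apply: wp_const => //; apply: wp_seq.
set s' := set_reg _ _ _; have E' : env s' by [].
apply: (@wp_for _ _ _ _ _ k (code_time + 5)
  (fun j s => heap s =1 mark entry_heap ws /\ reg s 22 = hits i v j)) => //.
- by split=> //; rewrite /hits big_geq.
- move=> j s'' jk s''9 F [s''h s''22].
  apply: wp_test_entry => //; [exact: env_frame F isT E'|by rewrite F..].
move=> t s'' tB F [s''h s''22]; have E'' := env_frame F isT E'.
have [s''0 s''1 s''2 s''3 [s''4 s''5]] := E''.
have s''8 : reg s'' 8 = i * k by rewrite F.
have s''20 : reg s'' 20 = v by rewrite F.
apply: wp_if; rewrite s''22 => Hz.
  apply: wp_skip; split; first by rewrite /scan_time; lia.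
  by rewrite /nonedge_cell (negPf Hz) cats0.
rewrite /nonedge_cell Hz eqxx.
apply: (@wp_for _ _ _ _ _ k 6
  (fun j s => heap s =1 mark entry_heap (ws ++ nonedge_col i v j))) => //.
- by rewrite cats0.
- move=> j s3' jk s39 F3 s3h.
  have s38 : reg s3' 8 = i * k by rewrite F3.
  have s320 : reg s3' 20 = v by rewrite F3.
  have wr : in_table (ws ++ nonedge_col i v j).
    by apply: in_table_cat => //; apply: nonedge_col_in => //; lia.
  have E3 := env_frame F3 isT E''.
  apply: (wp_conseq (wp_mark_nonedge im vn jk wr E3 s38 s39 s320 s3h)).
  by move=> t1 s4' [tB1 h]; split=> // x; rewrite h /nonedge_col gatherS catA.
by move=> t1 s4' tB1 F4 s4h; split=> //; rewrite /scan_time; lia.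
Qed.

Lemma wp_mark_nonedges s Q : env s -> heap s =1 entry_heap ->
  (forall t s', t <= m * (n * (scan_time + 3) + 7) + 3 -> env s' ->
     heap s' =1 mark entry_heap (nonedge_tab m) -> Q t s') ->
  wp W mark_nonedges s Q.
Proof.
move=> E sh HQ; have [s0 s1 s2 s3 [s4 s5]] := E.
apply: (@wp_for _ _ _ _ _ m (n * (scan_time + 3) + 4)
  (fun i s => heap s =1 mark entry_heap (nonedge_tab i))) => //.
- move=> i s' im s'6 F s'h.
  have E' := env_frame F isT E; have [s'0 s'1 s'2 s'3 [s'4 s'5]] := E'.
  apply: wp_seq; apply: wp_mul => /=; rewrite s'6 s'1.
    by have := entry_baseW; rewrite /entry_base /nonedge_base; nia.
  set s'' := set_reg _ _ _; have E'' : env s'' by [].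
  apply: (@wp_for _ _ _ _ _ n scan_time
    (fun v s => heap s =1 mark entry_heap (nonedge_tab i ++ nonedge_rows i v))) => //.
  + by move=> x; rewrite cats0 s'h.
  + move=> v s3' vn s320 F3 s3h.
    have s38 : reg s3' 8 = i * k by rewrite F3.
    have wr : in_table (nonedge_tab i ++ nonedge_rows i v).
      by apply: in_table_cat; [apply: nonedge_tab_in | apply: nonedge_rows_in] => //; lia.
    apply: (wp_conseq (wp_scan_vertex im vn wr (env_frame F3 isT E'') s38 s320 s3h)).
    by move=> t1 s4' [tB h]; split=> // x; rewrite h /nonedge_rows gatherS catA.
  move=> t s3' tB F3 s3h; split; first by lia.
  by move=> x; rewrite s3h /nonedge_tab gatherS.
move=> t s' tB F s'h; apply: HQ => //; first by lia.
exact: env_frame F isT E.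
Qed.

(** The heap below [entry_base] stays intact, so the table of non-edges can still be read while
    edges overwrite the entries. *)
Definition emitted (E : seq (seq nat)) s := [/\ reg s 24 = size E,
  reg s 23 = entry_base + 2 * size E, size (flatten E) = 2 * size E,
  (forall x, x < entry_base -> heap s x = nonedge_heap x)
  & forall x, x < size (flatten E) -> heap s (entry_base + x) = nth 0 (flatten E) x].

Lemma wp_emit_pair u v E s : u < n -> v < n -> env s ->
  reg s 6 = u -> reg s 20 = v -> emitted E s -> size E <= u * n + v ->
  wp W emit_pair s (fun t s' => t <= 12 /\ emitted (E ++ edge_cell u v) s').
Proof.
move=> un vn [s0 s1 s2 s3 [s4 s5]] s6 s20 [s24 s23 szE sl sE] Ele.
have := nonedge_lt un vn; rewrite {1}/nonedge => ne.
apply: wp_seq; apply: wp_sub; apply: wp_if => /=; rewrite s20 s6 => uv; last first.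
  apply: wp_skip; rewrite /edge_cell (_ : (u < v) = false) ?cats0; last by lia.
  by split.
have luv : u < v by lia.
apply: wp_seq; apply: wp_mul => /=; rewrite s6 s0; first by lia.
apply: wp_seq; apply: wp_add => /=; rewrite s20; first by lia.
apply: wp_seq; apply: wp_add => /=; rewrite s4; first by lia.
apply: wp_seq; apply: wp_read => /=; rewrite -/(nonedge u v) sl //.
rewrite /edge_cell luv; apply: wp_if => /= [/negPf->|->].
  by apply: wp_skip; rewrite cats0.
(* One slot per earlier pair at most is taken, so the two addresses written next fit into a word. *)
have nn : size E < n * n by nia.
apply: wp_seq; apply: wp_write => /=; rewrite s23 s6.
apply: wp_seq; apply: wp_add => /=; rewrite s23 s3; first by lia.
apply: wp_seq; apply: wp_write => /=; rewrite s20.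
apply: wp_seq; apply: wp_add => /=; rewrite s3; first by lia.
apply: wp_add => /=; rewrite s24 s3; first by lia.
split=> //; rewrite /emitted flatten_cat !size_cat /= szE; split=> //=; try lia.
- move=> x xT; rewrite ifF; last by lia.
  by rewrite ifF ?sl; lia.
- move=> x xE; rewrite nth_cat szE; case: ltnP => xE'.
    rewrite ifF; last by lia.
    by rewrite ifF ?sE ?szE //; lia.
  (* Only the two new cells are left: the second end point, then the first. *)
  case: (eqVneq x (2 * size E).+1) => [->|xn].
    by rewrite ifT ?subSnn //; lia.
  have -> : x = 2 * size E by lia.
  rewrite ifF; last by lia.
  by rewrite eqxx subnn.
Qed.

Lemma wp_emit_edges s Q : env s -> heap s =1 nonedge_heap ->
  (forall t s', t <= n * (n * 15 + 6) + 5 -> env s' -> emitted (edge_tab n) s' ->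
     Q t s') ->
  wp W emit_edges s Q.
Proof.
move=> E sh HQ; have [s0 s1 s2 s3 [s4 s5]] := E.
apply: wp_seq; apply: wp_const => //; apply: wp_seq.
apply: wp_add => /=; rewrite s5; first by lia.
set s' := set_reg _ _ _; have E' : env s' by [].
have [s'0 s'1 s'2 s'3 [s'4 s'5]] := E'.
apply: (@wp_for _ _ _ _ _ n (n * 15 + 3) (fun u => emitted (edge_tab u))) => //.
- by split=> //=; rewrite addn0 muln0.
- move=> u s'' un s''6 F s''h.
  have E'' := env_frame F isT E'; have [s''0 s''1 s''2 s''3 [s''4 s''5]] := E''.
  apply: (@wp_for _ _ _ _ _ n 12 (fun v => emitted (edge_tab u ++ edge_row u v))) => //.
  + by rewrite cats0.
  + move=> v s3' vn s320 F3 s3h.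
    have s36 : reg s3' 6 = u by rewrite F3.
    apply: (wp_conseq (wp_emit_pair un vn (env_frame F3 isT E'') s36 s320 s3h _)).
      by rewrite size_cat; have := size_edge_tab u; have := size_edge_row u v; lia.
    by move=> t1 s4' [tB h]; rewrite /edge_row gatherS catA.
  move=> t s3' tB F3 s3h; split; first by lia.
  by rewrite /edge_tab gatherS.
move=> t s'' tB F s''h; apply: HQ => //; first by lia.
exact: env_frame F isT E'.
Qed.

Lemma wp_reconstruct s : reg s 0 = n -> reg s 1 = k -> reg s 2 = m ->
  heap s =1 h0 ->
  wp W reconstruct s (fun t s' =>
    [/\ t <= m * (k * (code_time + 9) + 7) + m * (n * (scan_time + 3) + 7)
             + n * (n * 15 + 6) + 20,
        reg s' 0 = size (edge_tab n)
      & forall x, x < size (flatten (edge_tab n)) ->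
          heap s' (reg s' 1 + x) = nth 0 (flatten (edge_tab n)) x]).
Proof.
move=> s0 s1 s2 sh.
have B : m * k + n * n + n ^ k + 2 * n * n <= W by exact: entry_baseW.
apply: wp_seq; apply: wp_seq; apply: wp_const => /=; first by lia.
apply: wp_seq; apply: wp_mul => /=; rewrite s2 s1; first by lia.
apply: wp_seq; apply: wp_mul => /=; rewrite s0; first by lia.
apply: wp_add => /=; first by lia.
apply: wp_seq; apply: wp_mark_entries => // t1 s1' t1B E1 s1h.
apply: wp_seq; apply: wp_mark_nonedges => // t2 s2' t2B E2 s2h.
apply: wp_seq; apply: wp_emit_edges => // t3 s3' t3B E3 [s324 s323 sz sl sE].
have [_ _ _ _ [_ s35]] := E3.
apply: wp_seq; apply: wp_const => //; apply: wp_seq.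
have Z := size_edge_tab n.
apply: wp_add => /=; rewrite s324 addn0; first by lia.
apply: wp_add => /=; rewrite s35 addn0; first by lia.
by split=> //=; lia.
Qed.

End Tables.

(** * Correctness and running time *)

Lemma nth_flatten_uniform (T : Type) (x0 : T) (k : nat) (L : seq (seq T)) i a :
  all (fun l => size l == k) L -> i < size L -> a < k ->
  nth x0 (flatten L) (i * k + a) = nth x0 (nth [::] L i) a.
Proof.
elim: L i => [|l L IHL] [|i] //= /andP[/eqP lk Lk] iL ak.
  by rewrite nth_cat lk ak.
rewrite nth_cat lk mulSn -addnA ltnNge leq_addr /= addKn.
exact: IHL.
Qed.

(** Without repetitions, dropping a position is the same as removing the element found there. *)
Lemma code_except_nth n s j : uniq s -> j < size s ->
  code_except n (size s) j (nth 0 s) = code n (rem (nth 0 s j) s).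
Proof.
move=> us js; rewrite /code_except rem_filter //; congr code.
transitivity [seq x <- mkseq (nth 0 s) (size s) | x != nth 0 s j].
  rewrite /mkseq filter_map; congr map.
  by apply: eq_in_filter => a; rewrite mem_iota /= => a_s; rewrite nth_uniq.
by rewrite mkseq_nth.
Qed.

(** * Codes as names of vertex sets *)

Section SetCodes.
Variable n : nat.
Implicit Types l : seq 'I_n.

Definition rem_code l (x : 'I_n) : nat := code n (map val (rem x l)).

Lemma all_map_val l : all (ltn^~ n) (map val l).
Proof. by apply/allP => _ /mapP[x _ ->]; apply: ltn_ord. Qed.

Lemma rem_codeP l1 l2 (x1 x2 : 'I_n) : uniq l1 -> uniq l2 ->
  size l1 = size l2 -> x1 \in l1 -> x2 \in l2 ->
  rem_code l1 x1 = rem_code l2 x2 <->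
  [set y in l1] :\ x1 = [set y in l2] :\ x2.
Proof.
move=> u1 u2 sz i1 i2; split=> [E|/setP E].
  have p12 : perm_eq (rem x1 l1) (rem x2 l2).
    apply: (perm_map_inj val_inj); apply: code_inj E; rewrite ?all_map_val //.
    - by rewrite !size_map !size_rem // sz.
    - by rewrite (map_inj_uniq val_inj) rem_uniq.
    - by rewrite (map_inj_uniq val_inj) rem_uniq.
  apply/setP => y; have := perm_mem p12 y.
  by rewrite !mem_rem_uniq // !inE.
apply/perm_code/perm_map/uniq_perm; rewrite ?rem_uniq // => y.
by have := E y; rewrite !mem_rem_uniq // !inE.
Qed.

End SetCodes.

(** * From positions in the input to connected sets *)

Section Listing.
Variables (n k : nat) (e : rel 'I_n) (L : seq (seq 'I_n)).
Hypothesis k_gt0 : 0 < k.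
Hypothesis listL : listing (connected_ksets e k) L.

Lemma listing_mem l : l \in L -> [set x in l] \in connected_ksets e k.
Proof.
case/andP: listL => _ p lL.
by rewrite -mem_enum -(perm_mem p); apply: map_f.
Qed.

Lemma listing_uniq l : l \in L -> uniq l.
Proof. by case/andP: listL => /allP u _ /u. Qed.

Lemma listing_size l : l \in L -> size l = k.
Proof.
move=> lL; have := listing_mem lL; rewrite inE => /andP[/eqP <- _].
by rewrite cardsE; apply/esym/card_uniqP/listing_uniq.
Qed.

Lemma listing_ex A : A \in connected_ksets e k ->
  exists2 l, l \in L & A = [set x in l].
Proof.
case/andP: listL => _ p; rewrite -mem_enum -(perm_mem p) => /mapP[l lL ->].
by exists l.
Qed.

Lemma words_nth i a : i < size L -> a < k ->
  nth 0 (words L) (i * k + a) = nth 0 (map val (nth [::] L i)) a.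
Proof.
move=> iL ak; rewrite /words map_flatten nth_flatten_uniform ?size_map //.
  by rewrite (nth_map [::]).
by apply/allP => _ /mapP[l lL ->]; rewrite size_map listing_size.
Qed.

Lemma size_words : size (words L) = size L * k.
Proof.
rewrite size_map size_flatten /shape; move: listing_size.
elim: L => [|l L' IHL] //= H; rewrite H ?mem_head // IHL ?mulSn // => l' l'L.
by rewrite H // inE l'L orbT.
Qed.

Let h0 := nth 0 (words L).
Let m := size L.

Lemma member_words l j : l \in L -> j < k ->
  member k h0 (index l L) j = nth 0 (map val l) j.
Proof.
by move=> lL jk; rewrite /member /h0 words_nth ?index_mem // nth_index.
Qed.

Lemma member_index l (x : 'I_n) : l \in L -> x \in l ->
  member k h0 (index l L) (index x l) = x.
Proof.
move=> lL xl; rewrite member_words // ?(nth_map x) ?index_mem ?nth_index //.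
by rewrite -(listing_size lL) index_mem.
Qed.

Lemma rest_code_words l (x : 'I_n) : l \in L -> x \in l ->
  rest_code n k h0 (index l L) (index x l) = rem_code l x.
Proof.
move=> lL xl; have sl := listing_size lL; have ul := listing_uniq lL.
have xk : index x l < k by rewrite -sl index_mem.
rewrite /rest_code (@eq_code_except _ _ _ _ (nth 0 (map val l))); last first.
  by move=> a ak; rewrite member_words.
rewrite -{1}sl -(size_map val l) code_except_nth ?size_map ?sl //; last first.
  by rewrite (map_inj_uniq val_inj).
rewrite (nth_map x) ?index_mem // nth_index // /rem_code !rem_filter //.
  by rewrite filter_map.
by rewrite (map_inj_uniq val_inj).
Qed.

Lemma index_ex i j : i < m -> j < k ->
  exists l (x : 'I_n), [/\ l \in L, x \in l, i = index l L & j = index x l].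
Proof.
move=> im jk; have lL : nth [::] L i \in L by apply: mem_nth.
have jl : j < size (nth [::] L i) by rewrite (listing_size lL).
have [x0 _] : exists x, x \in nth [::] L i.
  by case: (nth [::] L i) jl => // x l _; exists x; rewrite mem_head.
exists (nth [::] L i), (nth x0 (nth [::] L i) j); split=> //.
- exact: mem_nth.
(* The lists are pairwise distinct because the sets they denote are. *)
- rewrite index_uniq //; case/andP: listL => _ /perm_uniq.
  by rewrite enum_uniq => /map_uniq.
- by rewrite index_uniq ?listing_uniq.
Qed.

Lemma member_lt_n i a : i < m -> a < k -> member k h0 i a < n.
Proof.
move=> im ak; have [l [x [lL xl -> ->]]] := index_ex im ak.
by rewrite member_index.
Qed.

Lemma rest_code_lt_n i j : i < m -> j < k -> rest_code n k h0 i j < n ^ k.-1.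
Proof.
move=> im jk; have [l [x [lL xl -> ->]]] := index_ex im jk.
rewrite rest_code_words // /rem_code -(listing_size lL) -(size_rem xl) -(size_map val).
by rewrite code_ltX ?all_map_val // (map_inj_uniq val_inj) rem_uniq ?listing_uniq.
Qed.

Lemma h0_eq0 x : nonedge_base k m <= x -> h0 x = 0.
Proof. by move=> Nx; rewrite /h0 nth_default // size_words. Qed.

(** Positions i, j are traded for a list and a member of it, and equality of codes for equality of
    the sets with one element removed. *)
Lemma nonedge_certified (u v : 'I_n) :
  nonedge_heap n k m h0 (nonedge n k m u v) != 0 <->
  exists A, [/\ A \in connected_ksets e k, u \in A & certifies e k A v].
Proof.
have n0 : 0 < n by apply: leq_ltn_trans (ltn_ord u).
apply: (iff_trans (nonedge_markedP n0 k_gt0 member_lt_n h0_eq0 (ltn_ord u) (ltn_ord v))).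
have ix l (x : 'I_n) : l \in L -> x \in l -> index x l < k.
  by move=> lL xl; rewrite -(listing_size lL) index_mem.
have codeP l1 l2 (x1 x2 : 'I_n) : l1 \in L -> l2 \in L -> x1 \in l1 ->
    x2 \in l2 -> rest_code n k h0 (index l1 L) (index x1 l1) =
      rest_code n k h0 (index l2 L) (index x2 l2) <->
    [set y in l1] :\ x1 = [set y in l2] :\ x2.
  move=> l1L l2L x1l x2l; rewrite !rest_code_words //; apply: rem_codeP => //;
  by rewrite ?listing_uniq ?listing_size.
split=> [[i [j [im jk eu H]]]|[A [Ak uA cert]]].
  move: eu H; have [l [x [lL xl -> ->]]] := index_ex im jk.
  rewrite member_index // => /val_inj <- H.
  exists [set x in l]; split; [exact: listing_mem | by rewrite inE |].
  move=> y B; rewrite inE => yl /listing_ex[l2 l2L ->]; rewrite inE => vl2 E.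
  apply: (H (index y l) (index l2 L) (index v l2)).
  - exact: ix.
  - by rewrite index_mem.
  - exact: ix.
  - exact: member_index.
  - exact/codeP.
have [l lL AE] := listing_ex Ak.
have ul : u \in l by rewrite AE inE in uA.
have iL : index l L < m by rewrite index_mem.
exists (index l L), (index u l); split=> //; [exact: ix | exact: member_index |].
move=> j1 i2 j2 j1k i2m j2k.
have [l2 [x2 [l2L x2l -> ->]]] := index_ex i2m j2k.
have [l1 [y [l1L yl il]]] := index_ex iL j1k.
have {il l1L} ll : l1 = l by rewrite -(nth_index [::] l1L) -il nth_index.
subst l1 => ->; rewrite member_index // => /val_inj xv /codeP E.
apply: (cert y [set x in l2]).
- by rewrite AE inE.
- exact: listing_mem.
- by rewrite inE -xv.
- by rewrite -xv AE; apply: E.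
Qed.

(** There are at most binomial(n, k) sets, and multiplying by k! gives a falling factorial. *)
Lemma size_listing_fact : size L * k`! <= n ^ k.
Proof.
have -> : size L = #|connected_ksets e k|.
  by case/andP: listL => _ /perm_size; rewrite size_map -cardE.
apply: (@leq_trans ('C(n, k) * k`!)).
  rewrite leq_mul2r; apply/orP; right.
  rewrite -[n in 'C(n, _)]card_ord -card_draws; apply: subset_leq_card.
  by apply/subsetP => X; rewrite !inE => /andP[].
rewrite bin_ffact; elim: (k) => [|k' IH]; first by rewrite ffactn0.
by rewrite ffactnSr expnSr leq_mul ?leq_subr.
Qed.

End Listing.

(** The quotient is largest at k = 3, where it is 27 / 6; from there on (k + 1)^2 <= k^3 drives the
    induction. *)
Lemma expn3_fact k : k ^ 3 <= 5 * k`!.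
Proof.
case: k => [|[|[|]]] //; elim=> [|k IHk] //.
rewrite factS; move: IHk; set f := _`!; move: f => f IHk.
by rewrite !expnS !expn0 in IHk *; nia.
Qed.

Lemma gather_ord (T : Type) (n : nat) (f : nat -> seq T) :
  gather f n = flatten [seq f (val i) | i <- enum 'I_n].
Proof. by rewrite /gather -val_enum_ord -map_comp. Qed.

Lemma flatten_if (S T : Type) (P : pred S) (f : S -> T) s :
  flatten [seq if P x then [:: f x] else [::] | x <- s] = [seq f x | x <- s & P x].
Proof. by elim: s => //= x s ->; case: (P x). Qed.

(** * The emitted list of edges *)

Section Output.
Variables (n : nat) (e : rel 'I_n).
Hypotheses (e_sym : symmetric e) (e_irr : irreflexive e).

(** The order is that in which [emit_edges] visits the pairs, so the output can be compared as a
    sequence. *)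
Definition edge_list : seq (seq 'I_n) :=
  flatten [seq [seq [:: u; v] | v : 'I_n <- enum 'I_n & (u < v) && e u v]
          | u : 'I_n <- enum 'I_n].

Lemma edge_listP l :
  reflect (exists u v : 'I_n, [/\ u < v, e u v & l = [:: u; v]])
          (l \in edge_list).
Proof.
apply: (iffP flatten_mapP) => [[u _ /mapP[v]]|[u [v [uv euv ->]]]].
  by rewrite mem_filter => /andP[/andP[uv euv] _] ->; exists u, v.
exists u; first by rewrite mem_enum.
by apply: map_f; rewrite mem_filter uv euv mem_enum.
Qed.

Lemma edge_list_uniq : uniq edge_list.
Proof.
have -> : edge_list =
    [seq l <- [seq [:: u; v] | u <- enum 'I_n, v <- enum 'I_n] |
      [exists u : 'I_n, exists v : 'I_n, [&& u < v, e u v & l == [:: u; v]]]].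
  rewrite filter_flatten -map_comp /edge_list; congr flatten.
  apply: eq_map => u /=; rewrite filter_map; congr map.
  apply: eq_filter => v /=; apply/idP/existsP => [/andP[uv euv]|[u' /existsP[v']]].
    by exists u; apply/existsP; exists v; rewrite uv euv eqxx.
  by move=> /and3P[uv euv /eqP[-> ->]]; rewrite uv.
apply: filter_uniq; apply: allpairs_uniq; rewrite ?enum_uniq //.
by move=> [u v] [u' v'] _ _ /= [-> ->].
Qed.

Lemma listing_edge_list : listing (edge_set e) edge_list.
Proof.
apply/andP; split.
  apply/allP => l /edge_listP[u [v [uv _ ->]]]; rewrite /= inE andbT.
  by apply: contraTneq uv => ->; rewrite ltnn.
apply: uniq_perm; rewrite ?enum_uniq //.
  rewrite map_inj_in_uniq ?edge_list_uniq //.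
  move=> _ _ /edge_listP[u [v [uv _ ->]]] /edge_listP[u' [v' [uv' _ ->]]] /setP E.
  (* Equality of the two sets is tested at the four end points; since u < v and u' < v', arithmetic
     then identifies them. *)
  have := (E u, E v, E u', E v'); rewrite !inE !eqxx !orbT -!val_eqE /=.
  move=> [[[H1 H2] H3] H4].
  have [uu vv] : u = u' :> nat /\ v = v' :> nat by lia.
  by rewrite (val_inj uu) (val_inj vv).
move=> X; rewrite mem_enum inE.
apply/mapP/existsP => [[_ /edge_listP[u [v [uv euv ->]]] ->]|].
  by exists u; apply/existsP; exists v; rewrite euv; apply/eqP/setP => x; rewrite !inE.
move=> [u /existsP[v /andP[euv /eqP->]]].
case: (ltngtP u v) => [uv|vu|/val_inj uv].
- exists [:: u; v]; first by apply/edge_listP; exists u, v.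
  by apply/setP => x; rewrite !inE.
- exists [:: v; u]; first by apply/edge_listP; exists v, u; rewrite e_sym.
  by apply/setP => x; rewrite !inE orbC.
- by rewrite uv e_irr in euv.
Qed.

Lemma edge_tab_edge_list k m h0 :
  (forall u v : 'I_n, u != v ->
     (nonedge_heap n k m h0 (nonedge n k m u v) != 0) = ~~ e u v) ->
  edge_tab n k m h0 n = [seq map val l | l <- edge_list].
Proof.
move=> H; rewrite /edge_tab gather_ord map_flatten -(map_comp (map (map val))).
congr flatten.
apply: eq_map => u /=; rewrite /edge_row gather_ord -(map_comp (map val)) -flatten_if.
congr flatten; apply: eq_map => v /=; rewrite /edge_cell.
case: (ltnP u v) => //= uv.
by rewrite (negb_inj (H u v _)) // -val_eqE /=; lia.
Qed.

End Output.

(** The number 700 n^(k+1) bounds both the running time and the words, and so every address. *)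
Lemma reconstruct_correct (n k : nat) (e : rel 'I_n) :
  symmetric e -> irreflexive e -> 1 < k <= n ->
  (forall u v : 'I_n,
     (exists A, [/\ A \in connected_ksets e k, u \in A & certifies e k A v])
     <-> (u != v) && ~~ e u v) ->
  reconstructs_in reconstruct (700 * n ^ k.+1) k e.
Proof.
move=> e_sym e_irr /andP[k1 kn] cert L listL.
have k0 : 0 < k by lia.
have n0 : 0 < n by lia.
(* This is where the factor k^3 of the running time is absorbed, leaving a constant independent of
   [k]. *)
have mk : size L * k ^ 3 <= 5 * n ^ k.
  apply: (@leq_trans (size L * (5 * k`!))).
    by rewrite leq_mul2l expn3_fact orbT.
  by have := size_listing_fact listL; lia.
have nk : n * n <= n ^ k.
  by rewrite mulnn; apply: leq_pexp2l.
have sz : 700 * n ^ k.+1 = 700 * (n * n ^ k) by rewrite expnS.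
set W := 700 * _.
have k3 : k ^ 3 = k * k * k by rewrite !expnS expn0; lia.
rewrite k3 in mk.
set N := n ^ k in mk nk sz; set m := size L in mk.
have mkk : m * k <= 5 * N.
  by apply: leq_trans mk; rewrite leq_mul2l; apply/orP; right; nia.
have mN : m <= 5 * N by apply: leq_trans mkk; rewrite leq_pmulr.
have NW : N <= n * N by rewrite leq_pmull.
have nN : n <= N by apply: leq_trans nk; rewrite leq_pmull.
have := @wp_reconstruct n k m (nth 0 (words L)) n0 k0
  (member_lt_n listL) (h0_eq0 listL) W.
move=> /(_ _ _ _ _ _ (rest_code_lt_n listL) (input_state k L)).
move=> /(_ _ _ _ _ _ erefl erefl erefl (frefl _)).
case.
- by lia.
- by lia.
- by lia.
- by rewrite -/N; lia.
- by rewrite /entry_base /nonedge_base -/N; lia.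
move=> t [s [E [tB s0 sh]]]; exists t, s; split=> //.
  apply: leq_trans tB _.
  (* Lower-order terms are absorbed into the leading ones; with m k^3 <= 5 n^k the total coefficient
     is 47 * 5 + 66 * 5 + 41 = 606, below 700. *)
  have c1 : code_time k <= 31 * (k * k) by rewrite /code_time; nia.
  have c2 : scan_time k <= 56 * (k * k * k).
    by rewrite /scan_time; move: (code_time k) c1 => c c1; nia.
  move: (code_time k) (scan_time k) c1 c2 => c d c1 c2.
  set K := k * k * k in c2 mk.
  have K1 : 0 < K by rewrite /K !muln_gt0 k0.
  have p1 : k * (c + 9) + 7 <= 47 * K by rewrite /K; nia.
  have p2 : n * (d + 3) + 7 <= 66 * (n * K) by nia.
  have q1 : m * (k * (c + 9) + 7) <= 47 * (m * K) by nia.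
  have q2 : m * (n * (d + 3) + 7) <= 66 * (n * (m * K)) by nia.
  have q3 : n * (m * K) <= n * (5 * N) by rewrite leq_mul2l mk orbT.
  have q4 : n * (n * 15 + 6) + 20 <= 41 * N by nia.
  by lia.
have T3 : edge_tab n k m (nth 0 (words L)) n = [seq map val l | l <- edge_list e].
  apply: edge_tab_edge_list => u v uv.
  apply/idP/idP => [/(nonedge_certified k0 listL)/cert/andP[]//|nuv].
  by apply/(nonedge_certified k0 listL)/cert; rewrite uv.
exists (edge_list e); split.
- exact: listing_edge_list.
- by rewrite s0 T3 size_map.
- by move=> x; rewrite /words map_flatten -T3; apply: sh.
Qed.

Local Open Scope ring_scope.

Theorem theorem6 (R : realType) :
  exists (P : prog) (C n0 : nat),
    forall (n : nat) (e : rel 'I_n),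
      (n0 <= n)%N -> symmetric e -> irreflexive e -> random_like R e ->
      (forall k : nat, (2 <= k)%N ->
         k%:R <= n%:R / 2 - 4 * sqrt_nlogn R n ->
         reconstructs_in P (C * n ^ k.+1)%N k e)
      /\
      (forall S : {set 'I_n},
         n%:R / 2 + 4 * sqrt_nlogn R n <= #|S|%:R ->
         connected_in e S).
Proof.
have [n0 large] := large_n R.
exists reconstruct, 700%N, n0 => n e n0n e_sym e_irr rl.
have [l1 l2 l3] := large n n0n.
split=> [k k2 kn|S]; last exact: random_like_connected.
apply: reconstruct_correct => // [|u v]; last exact: random_like_certificate kn.
rewrite k2 -(ler_nat R) /=; apply: le_trans kn _.
have real_le (x l q : R) : 0 <= x -> 1 <= l -> 2 * l + 1 <= q ->
  x / 2 - 4 * q <= x by lra.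
exact: real_le (ler0n _ _) l1 l2.
Qed.
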